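(* For $m,n\in\mathbb{N}$, $a\ge0$, $b\in\mathbb{R}$, $c,d>0$ let $$I_{m,n}:=\int_{-\infty}^\infty\frac{1}{\left(a^2(x-b)^2+c^2\right)^m}\frac{1}{\left(x^2+d^2\right)^n}\,dx .$$ There are real numbers $c^{m,n}_{i,j}$ ($m,n\in\mathbb{N}$, $i,j\in\mathbb{N}_0$), independent of $a,b,c,d$, such that the following hold. (1) $$I_{m,n}=\frac{\pi}{\left((c+ad)^2+a^2b^2\right)^{m+n-1}}\frac1{c^{2m-1}}\frac1{d^{2n-1}}\sum_{\substack{i,j,k\in\mathbb{N}_0,\ i+j+2k=2(m+n)-3\\ i\ge2m-1\ \text{or}\ j\ge2n-1}}c^{m,n}_{i,j}\,c^i(ad)^j(ab)^{2k}.$$ (2) With implicit constants depending only on $m,n$, $$I_{m,n}\lesssim\frac{a^{2n-1}}{\left((c+ad)^2+a^2b^2\right)^n}\frac1{c^{2m-1}}+\frac1{\left((c+ad)^2+a^2b^2\right)^m}\frac1{d^{2n-1}}\le\frac{a^{2n-1}}{\left(a^2b^2+a^2d^2+c^2\right)^n}\frac1{c^{2m-1}}+\frac1{\left(a^2b^2+a^2d^2+c^2\right)^m}\frac1{d^{2n-1}}.$$ (3) The generating function of $I_{m,n}$ is $$\sum_{m,n\ge1}I_{m,n}y^mz^n=\frac{\pi yz}{\sqrt{c^2-y}\sqrt{d^2-z}}\;\frac{\sqrt{c^2-y}+a\sqrt{d^2-z}}{\left(\sqrt{c^2-y}+a\sqrt{d^2-z}\right)^2+a^2b^2}.$$ (4)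 With $h(v,w):=(v+w)^2+1$, the generating function of the coefficients is $$\sum_{i,j\ge0,\ m,n\ge1}c^{m,n}_{i,j}v^iw^jy^mz^n=\frac{h\,yz}{\sqrt{1-hy}\sqrt{1-hz}}\;\frac{v\sqrt{1-hy}+w\sqrt{1-hz}}{\left(v\sqrt{1-hy}+w\sqrt{1-hz}\right)^2+1},\qquad h=h(v,w).$$ (5) $c^{m,n}_{i,j}=0$ unless $i+j\equiv1\pmod 2$, $i+j\le2(m+n)-3$ and ($i\ge2m-1$ or $j\ge2n-1$). If these conditions are satisfied, then $$c^{m,n}_{i,j}=\sum_{\substack{0\le r\le i,\ 0\le s\le j\\ r+s\equiv1\,(2)}}(-1)^{m+n+\frac{r+s-1}2}\binom{r+s}{s}\binom{\frac{r-1}2}{m-1}\binom{\frac{s-1}2}{n-1}\binom{m+n-1}{m+n-1-\frac{i+j-r-s}2}\binom{i+j-r-s}{i-r}.$$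
   Context: $\mathbb{N}$ excludes zero, $\mathbb{N}_0=\mathbb{N}\cup\{0\}$. For $\alpha\in\mathbb{R}$ and $k\in\mathbb{N}_0$, $\binom{\alpha}{k}=\frac{\alpha(\alpha-1)\cdots(\alpha-k+1)}{k!}$. $0^0=1$. The generating-function identities are identities of power series (formal, or for small arguments). $A\lesssim B$ means $A\le C B$ with a constant $C$ independent of the variables involved. *)

(* Defs.v *)
From HB Require Import structures.
From mathcomp Require Import all_boot all_order all_algebra finmap.
From mathcomp Require Import all_classical all_reals all_analysis.
From mathcomp.analysis.showcase Require summability.
Set Implicit Arguments.
Unset Strict Implicit.
Unset Printing Implicit Defensive.
Import Order.TTheory GRing.Theory Num.Theory.
Import numFieldNormedType.Exports.
Local Open Scope classical_set_scope.
Local Open Scope ring_scope.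

(* Extended-real valued, so that an equation [integral_mn a b c d m n = r%:E]
   also asserts that the integral converges. *)
Definition integral_mn {R : realType} (a b c d : R) (m n : nat) : \bar R :=
  (\int[lebesgue_measure]_x
     ((a ^+ 2 * (x - b) ^+ 2 + c ^+ 2) ^- m * (x ^+ 2 + d ^+ 2) ^- n)%:E)%E.

Definition gbinom {R : realType} (alpha : R) (k : nat) : R :=
  (\prod_(l < k) (alpha - l%:R)) / k`!%:R.

(* Unconditional (equivalently, absolute) convergence of the family [f] to [s]:
   the sums over finite subsets of [T], directed by inclusion, tend to [s]. *)
Definition has_sum {R : realType} {T : choiceType} (f : T -> R) (s : R) : Prop :=
  summability.partial_sum f @ summability.totally --> s.

(* Main.v *)
Require Import Defs.
From HB Require Import structures.
From mathcomp Require Import all_boot all_order all_algebra.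
From mathcomp Require Import all_classical all_reals all_analysis.
From mathcomp Require Import measurable_realfun ring lra finmap zify.
Set Implicit Arguments.
Unset Strict Implicit.
Unset Printing Implicit Defensive.
Import Order.TTheory GRing.Theory Num.Theory.
Import numFieldNormedType.Exports.
Local Open Scope classical_set_scope.
Local Open Scope ring_scope.

(* I_(1,1) is computed by partial fractions. Since 1/(A - y) is a geometric
   series in y/A, replacing c, d by sqrt (c^2 - y), sqrt (d^2 - z) in the closed
   form of I_(1,1) gives the generating function (3).
   For (1), I_(m+1,n) = -(2mc)^-1 dI_(m,n)/dc and I_(m,n+1) = -(2nd)^-1 dI_(m,n)/dd
   show that I_(m,n) is pi P_(m,n) / (H^(m+n-1) c^(2m-1) d^(2n-1)), where
   H = (c + ad)^2 + (ab)^2 and P_(m,n) is a polynomial in c, ad and (ab)^2,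
   homogeneous of degree 2(m+n)-3, given by a recursion on m and n.
   On formal power series, the same recursion acts on H^-(m+n-1) P_(m,n)
   diagonally, multiplying the coefficient of c^r (ad)^s by (2m-1-r)/(2m), resp.
   (2n-1-s)/(2n). Starting from (v+w)/((v+w)^2+1) = sum_k (-1)^k (v+w)^(2k+1),
   this yields the formula (5), whose terms vanish unless r >= 2m-1 or s >= 2n-1;
   the degree bound comes from the homogeneity of P_(m,n).
   The estimate (2) bounds each monomial of P_(m,n) separately, and (4) follows
   from (5) by exchanging the order of an absolutely convergent sum. *)

(** * The integral for m = n = 1 *)

(** The closed form of I_(1,1) is uniform in the parameters, its derivation is not: the limits at
    infinity need a > 0, and partial fractions break down when the two quadratics are proportional
    (c = ad, b = 0). These cases get their own antiderivatives. The recursion is written with the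
    Euler operators c d/dc and d d/dd = (ad) d/d(ad). Thus nothing is divided by a, and a = 0 stays
    included; moreover these operators are diagonal on monomials and keep the total degree. Writing
    P = H^N G, the derivative of H^N cancels the middle term of the recursion, which is why G
    evolves diagonally. For this computation (ab)^2 is set to 1, since homogeneity restores the
    power of ab. Formal power series are replaced by polynomial truncations of G, and equality by
    congruence modulo high total degree, which the recursion respects. The factors picked up by G
    are those of the binomial series of (1 - y)^((r-1)/2), and these series are summed again in
    (4). *)

Lemma ge0_continuous_FTC2T (R : realType) (f F : R -> R) (l1 l2 : R) :
  (forall x, 0 <= f x) -> continuous f -> (forall x : R, is_derive x 1 F (f x)) ->
  F x @[x --> -oo] --> l1 -> F x @[x --> +oo] --> l2 ->
  (\int[lebesgue_measure]_x (f x)%:E = (l2 - l1)%:E)%E.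
Proof.
move=> f0 cf dF Fl1 Fl2.
have cF : continuous F.
  move=> x; apply: differentiable_continuous; apply/derivable1_diffP.
  by have [] := dF x.
have mf : measurable_fun setT f by exact: continuous_measurable_fun.
have mI (A : set R) : measurable A -> measurable_fun A (fun x => (f x)%:E).
  by move=> mA; apply/measurable_EFinP; exact: measurable_funTS.
rewrite -(setUv `[0, +oo[%classic) ge0_integral_setU//=; first last.
- exact/disj_setPCl.
- by move=> x _; rewrite lee_fin.
- by apply: mI; apply: measurableU => //; exact: measurableC.
- exact: measurableC.
rewrite (@ge0_continuous_FTC2y _ f F 0 l2)//; first last.
- by move=> x _; rewrite derive1E; have [_ ->] := dF x.
- by apply: cvg_at_right_filter; exact: cF.
- exact: continuous_subspaceT.
rewrite setCitvr integral_itv_bndo_bndc; last first.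
  exact: mI.
(* The left half-line is reflected onto the right one, so that the half-line theorem serves both
   sides. *)
rewrite -oppr0 ge0_integration_by_substitutionNy//; last first.
  exact: continuous_subspaceT.
have cfN : continuous (f \o -%R).
  by move=> x; apply: continuous_comp; [exact: opp_continuous|exact: cf].
pose F' (x : R) := - F (- x).
have dF' (x : R) : is_derive x 1 F' (f (- x)).
  have d := dF (- x); rewrite -[f (- x)]opprK -[- f _]mulrN1.
  rewrite (_ : F' = - (F \o -%R))//; apply: is_deriveN.
have cF' : continuous F'.
  move=> x; apply: differentiable_continuous; apply/derivable1_diffP.
  by have [] := dF' x.
have lF' : F' x @[x --> +oo] --> - l1.
  by apply: cvgN; exact/(cvgNy_compNP F (nbhs l1)).
rewrite (@ge0_continuous_FTC2y _ (f \o -%R) F' 0 (- l1))//; first last.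
- by move=> x _; rewrite derive1E; have [_ ->] := dF' x.
- by apply: cvg_at_right_filter; exact: cF'.
- exact: continuous_subspaceT.
- by move=> x _; exact: f0.
by rewrite /F' oppr0 -!EFinB -EFinD; congr EFin; lra.
Qed.

Lemma is_derive1_expn (R : realType) (f : R -> R) (n : nat) (x df : R) :
  is_derive x 1 f df ->
  is_derive x 1 (fun y => f y ^+ n) (n%:R * f x ^+ n.-1 * df).
Proof.
move=> d; rewrite (_ : (fun y => f y ^+ n) = f ^+ n); last first.
  by apply/funext => y; rewrite exprfctE.
exact: is_deriveX.
Qed.

Section base_case.
Context {R : realType}.
Implicit Types a b c d x : R.

Lemma quad_gt0 a b c x : 0 < c -> 0 < a ^+ 2 * (x - b) ^+ 2 + c ^+ 2.
Proof.
by move=> c0; rewrite -exprMn ltr_wpDl ?sqr_ge0 ?exprn_gt0.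
Qed.

Lemma sqrD_gt0 d x : 0 < d -> 0 < x ^+ 2 + d ^+ 2.
Proof. by move=> d0; rewrite ltr_wpDl ?sqr_ge0 ?exprn_gt0. Qed.

(** Each logarithm diverges, but the quotient of the two quadratics, as a function [g] of t = 1/x,
    extends continuously to t = 0 with value a^2. *)
Lemma cvgy_ln_quad a b c d : 0 < a -> 0 < c -> 0 < d ->
  ln (a ^+ 2 * (x - b) ^+ 2 + c ^+ 2) - ln (x ^+ 2 + d ^+ 2) @[x --> +oo]
    --> (ln (a ^+ 2) : R).
Proof.
move=> a0 c0 d0.
pose g (t : R) := (a ^+ 2 * (1 - b * t) ^+ 2 + c ^+ 2 * t ^+ 2) /
                  (1 + d ^+ 2 * t ^+ 2).
have g0 : g 0 = a ^+ 2 by rewrite /g; field.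
have cg : {for 0, continuous (fun t => ln (g t))}.
  apply: differentiable_continuous; apply/derivable1_diffP.
  have h1 : 1 + d ^+ 2 * 0 ^+ 2 != 0 :> R by rewrite expr0n mulr0 addr0 oner_neq0.
  have ? : is_derive (g 0) 1 (@ln R) (g 0)^-1.
    by apply: is_derive1_ln; rewrite g0 exprn_gt0.
  exact: ex_derive.
have cV : (x^-1 : R) @[x --> +oo] --> (0 : R).
  apply/gtr0_cvgV0; last exact: cvg_id.
  exact: nbhs_pinfty_gt.
have := cvg_comp (fun x : R => x^-1) (fun t => ln (g t)) cV cg.
rewrite g0; apply: cvg_trans.
apply: near_eq_cvg; near=> x.
have x0 : 0 < x by near: x; exact: nbhs_pinfty_gt.
rewrite /= -ln_div ?posrE ?quad_gt0 ?sqrD_gt0//; congr ln.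
rewrite /g; field.
by rewrite !gt_eqF// sqrD_gt0.
Unshelve. all: by end_near. Qed.

Lemma cvgy_atan_affine a b c : 0 < a -> 0 < c ->
  atan (a * (x - b) / c) @[x --> +oo] --> (pi / 2 : R).
Proof.
move=> a0 c0; apply: (cvg_comp _ _ _ (@cvgy_atan R)).
apply: gt0_cvgMly; first by rewrite invr_gt0.
by apply: gt0_cvgMry => //; exact: cvg_addrr.
Qed.

Lemma continuous_integrand a b c d m n : 0 < c -> 0 < d ->
  continuous (fun x : R => (a ^+ 2 * (x - b) ^+ 2 + c ^+ 2) ^- m *
                        (x ^+ 2 + d ^+ 2) ^- n).
Proof.
move=> c0 d0 x; apply: differentiable_continuous; apply/derivable1_diffP.
have h1 : (a ^+ 2 * (x - b) ^+ 2 + c ^+ 2) ^+ m != 0.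
  by rewrite expf_neq0// gt_eqF// quad_gt0.
have h2 : (x ^+ 2 + d ^+ 2) ^+ n != 0 by rewrite expf_neq0// gt_eqF// sqrD_gt0.
by apply: derivableM; apply: derivableV => //; apply: ex_derive;
  apply: is_derive1_expn.
Qed.

Lemma integrand_ge0 a b c d m n x : 0 < c -> 0 < d ->
  0 <= (a ^+ 2 * (x - b) ^+ 2 + c ^+ 2) ^- m * (x ^+ 2 + d ^+ 2) ^- n.
Proof.
move=> c0 d0; rewrite mulr_ge0// invr_ge0 exprn_ge0// ltW//.
  exact: quad_gt0.
exact: sqrD_gt0.
Qed.

Lemma cvgNy_ln_quad a b c d : 0 < a -> 0 < c -> 0 < d ->
  ln (a ^+ 2 * (x - b) ^+ 2 + c ^+ 2) - ln (x ^+ 2 + d ^+ 2) @[x --> -oo]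
    --> (ln (a ^+ 2) : R).
Proof.
move=> a0 c0 d0; apply/cvgNy_compNP.
rewrite (_ : _ \o _ = fun x => ln (a ^+ 2 * (x - - b) ^+ 2 + c ^+ 2) -
                              ln (x ^+ 2 + d ^+ 2)); last first.
  by apply/funext => x /=; rewrite sqrrN -[- x - b]opprD sqrrN opprK.
exact: cvgy_ln_quad.
Qed.

Lemma cvgNy_atan_affine a b c : 0 < a -> 0 < c ->
  atan (a * (x - b) / c) @[x --> -oo] --> (- (pi / 2) : R).
Proof.
move=> a0 c0; apply/cvgNy_compNP.
rewrite (_ : _ \o _ = fun x => - atan (a * (x - - b) / c)); last first.
  by apply/funext => x /=; rewrite -atanN; congr atan; ring.
by apply: cvgN; exact: cvgy_atan_affine.
Qed.

Lemma integral11_nondegenerate a b c d : 0 < a -> 0 < c -> 0 < d ->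
  (c - a * d) ^+ 2 + a ^+ 2 * b ^+ 2 != 0 ->
  integral_mn a b c d 1 1 =
    (pi * (c + a * d) / (c * d * ((c + a * d) ^+ 2 + a ^+ 2 * b ^+ 2)))%:E.
Proof.
move=> a0 c0 d0 hm.
have hp : (c + a * d) ^+ 2 + a ^+ 2 * b ^+ 2 != 0.
  rewrite gt_eqF// -exprMn ltr_wpDr ?sqr_ge0//.
  by apply: exprn_gt0; apply: addr_gt0 => //; exact: mulr_gt0.
have [a0' c0' d0'] : [/\ a != 0, c != 0 & d != 0] by split; rewrite gt_eqF.
(* D is the resultant of the two quadratics; kappa, lambda, mu come from the
   partial fraction decomposition. *)
pose D := ((c + a * d) ^+ 2 + a ^+ 2 * b ^+ 2) *
          ((c - a * d) ^+ 2 + a ^+ 2 * b ^+ 2).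
pose kappa := - (a ^+ 2 * b) / D.
pose lambda := a * (a ^+ 2 * b ^+ 2 + a ^+ 2 * d ^+ 2 - c ^+ 2) / c / D.
pose mu := - (a ^+ 2 * d ^+ 2 - a ^+ 2 * b ^+ 2 - c ^+ 2) / d / D.
(* The logarithmic part has the same limit at both ends, so only [lambda + mu] survives in the
   integral. The form [1 * (x - 0) / d] makes the second arctangent an instance of the affine
   lemmas. *)
pose F x := kappa * (ln (a ^+ 2 * (x - b) ^+ 2 + c ^+ 2) - ln (x ^+ 2 + d ^+ 2))
  + lambda * atan (a * (x - b) / c) + mu * atan (1 * (x - 0) / d).
have lm : lambda + mu =
    (c + a * d) / (c * d * ((c + a * d) ^+ 2 + a ^+ 2 * b ^+ 2)).
  by rewrite /lambda /mu /D; field; rewrite !exprMn hp hm c0' d0'.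
have dF x : is_derive x 1 F
    ((a ^+ 2 * (x - b) ^+ 2 + c ^+ 2) ^- 1 * (x ^+ 2 + d ^+ 2) ^- 1).
  have hA := quad_gt0 a b x c0; have hB := sqrD_gt0 x d0.
  have ? := is_derive1_ln hA; have ? := is_derive1_ln hB.
  apply: is_derive_eq; rewrite /GRing.scale/= !expr1.
  rewrite /kappa /lambda /mu /D.
  have hA1 := lt0r_neq0 hA; have hB1 := lt0r_neq0 hB.
  have e1 : (1 + (a * (x - b) / c) ^+ 2)^-1 =
            c ^+ 2 / (a ^+ 2 * (x - b) ^+ 2 + c ^+ 2).
    by field; rewrite !exprMn hA1 c0'.
  have e2 : (1 + (1 * (x - 0) / d) ^+ 2)^-1 = d ^+ 2 / (x ^+ 2 + d ^+ 2).
    by field; rewrite hB1 d0'.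
  rewrite e1 e2; field.
  by rewrite !exprMn hp hm hA1 hB1 c0' d0'.
have FN : F x @[x --> -oo] -->
    kappa * ln (a ^+ 2) + lambda * (- (pi / 2)) + mu * (- (pi / 2)).
  apply: cvgD; last by apply: cvgMl_tmp; exact: cvgNy_atan_affine.
  apply: cvgD; last by apply: cvgMl_tmp; exact: cvgNy_atan_affine.
  by apply: cvgMl_tmp; exact: cvgNy_ln_quad.
have FP : F x @[x --> +oo] -->
    kappa * ln (a ^+ 2) + lambda * (pi / 2) + mu * (pi / 2).
  apply: cvgD; last by apply: cvgMl_tmp; exact: cvgy_atan_affine.
  apply: cvgD; last by apply: cvgMl_tmp; exact: cvgy_atan_affine.
  by apply: cvgMl_tmp; exact: cvgy_ln_quad.
rewrite /integral_mn (ge0_continuous_FTC2T _ _ dF FN FP).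
- by congr EFin; rewrite -[RHS]mulrA -lm; lra.
- by move=> x; exact: integrand_ge0.
- exact: continuous_integrand.
Qed.

Lemma integral11_a0 b c d : 0 < c -> 0 < d ->
  integral_mn 0 b c d 1 1 = (pi / (c ^+ 2 * d))%:E.
Proof.
move=> c0 d0; have [c0' d0'] : c != 0 /\ d != 0 by split; rewrite gt_eqF.
pose F x := (c ^+ 2 * d)^-1 * atan (1 * (x - 0) / d).
have dF x : is_derive x 1 F
    ((0 ^+ 2 * (x - b) ^+ 2 + c ^+ 2) ^- 1 * (x ^+ 2 + d ^+ 2) ^- 1).
  have hB := lt0r_neq0 (sqrD_gt0 x d0).
  apply: is_derive_eq; rewrite /GRing.scale/= !expr1 expr0n mul0r add0r.
  have e2 : (1 + (1 * (x - 0) / d) ^+ 2)^-1 = d ^+ 2 / (x ^+ 2 + d ^+ 2).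
    by field; rewrite hB d0'.
  by rewrite e2; field; rewrite hB c0' d0'.
have FN : F x @[x --> -oo] --> (c ^+ 2 * d)^-1 * - (pi / 2).
  by apply: cvgMl_tmp; exact: cvgNy_atan_affine.
have FP : F x @[x --> +oo] --> (c ^+ 2 * d)^-1 * (pi / 2).
  by apply: cvgMl_tmp; exact: cvgy_atan_affine.
rewrite /integral_mn (ge0_continuous_FTC2T _ _ dF FN FP).
- by congr EFin; lra.
- by move=> x; exact: integrand_ge0.
- exact: continuous_integrand.
Qed.

Lemma cvgy_div_sqrD d : 0 < d -> x / (x ^+ 2 + d ^+ 2) @[x --> +oo] --> (0 : R).
Proof.
move=> d0; pose g (t : R) := t / (1 + d ^+ 2 * t ^+ 2).
have g0 : g 0 = 0 by rewrite /g mul0r.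
have cg : {for 0, continuous g}.
  apply: differentiable_continuous; apply/derivable1_diffP.
  have h1 : 1 + d ^+ 2 * 0 ^+ 2 != 0 :> R by rewrite expr0n mulr0 addr0 oner_neq0.
  exact: ex_derive.
have cV : (x^-1 : R) @[x --> +oo] --> (0 : R).
  apply/gtr0_cvgV0; last exact: cvg_id.
  exact: nbhs_pinfty_gt.
have := cvg_comp (fun x : R => x^-1) g cV cg.
rewrite g0; apply: cvg_trans; apply: near_eq_cvg; near=> x.
have x0 : 0 < x by near: x; exact: nbhs_pinfty_gt.
have hB := lt0r_neq0 (sqrD_gt0 x d0).
by rewrite /= /g; field; rewrite hB gt_eqF.
Unshelve. all: by end_near. Qed.

Lemma cvgNy_div_sqrD d : 0 < d -> x / (x ^+ 2 + d ^+ 2) @[x --> -oo] --> (0 : R).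
Proof.
move=> d0; apply/cvgNy_compNP.
rewrite (_ : _ \o _ = fun x => - (x / (x ^+ 2 + d ^+ 2))); last first.
  by apply/funext => x /=; rewrite sqrrN mulNr.
by have := cvgN (cvgy_div_sqrD d0); rewrite oppr0; exact.
Qed.

(** Here the first quadratic is a^2 times the second, so the integrand is a multiple of (x^2 +
    d^2)^-2; its antiderivative has a rational part, which vanishes at both ends. *)
Lemma integral11_degenerate a d : 0 < a -> 0 < d ->
  integral_mn a 0 (a * d) d 1 1 = (pi / (2 * a ^+ 2 * d ^+ 3))%:E.
Proof.
move=> a0 d0; have [a0' d0'] : a != 0 /\ d != 0 by split; rewrite gt_eqF.
pose k := (2 * a ^+ 2 * d ^+ 3)^-1.
pose F x := k * d * (x / (x ^+ 2 + d ^+ 2)) + k * atan (1 * (x - 0) / d).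
have dF x : is_derive x 1 F
    ((a ^+ 2 * (x - 0) ^+ 2 + (a * d) ^+ 2) ^- 1 * (x ^+ 2 + d ^+ 2) ^- 1).
  have hB := lt0r_neq0 (sqrD_gt0 x d0).
  apply: is_derive_eq; rewrite /GRing.scale/= !expr1.
  have e2 : (1 + (1 * (x - 0) / d) ^+ 2)^-1 = d ^+ 2 / (x ^+ 2 + d ^+ 2).
    by field; rewrite hB d0'.
  rewrite e2 subr0 exprMn -mulrDr /k; field.
  by rewrite !exprMn -mulrDr mulf_neq0 ?expf_neq0//= hB a0' d0'.
have FN : F x @[x --> -oo] --> k * d * 0 + k * - (pi / 2).
  apply: cvgD; last by apply: cvgMl_tmp; exact: cvgNy_atan_affine.
  by apply: cvgMl_tmp; exact: cvgNy_div_sqrD.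
have FP : F x @[x --> +oo] --> k * d * 0 + k * (pi / 2).
  apply: cvgD; last by apply: cvgMl_tmp; exact: cvgy_atan_affine.
  by apply: cvgMl_tmp; exact: cvgy_div_sqrD.
rewrite /integral_mn (ge0_continuous_FTC2T _ _ dF FN FP).
- by congr EFin; rewrite -[in RHS]/k; lra.
- by move=> x; apply: integrand_ge0 => //; exact: mulr_gt0.
- by apply: continuous_integrand => //; exact: mulr_gt0.
Qed.

(** The second factor of the resultant is a sum of two squares: for a > 0 it vanishes only if c = ad
    and b = 0, which is the degenerate case. *)
Lemma integral11 a b c d : 0 <= a -> 0 < c -> 0 < d ->
  integral_mn a b c d 1 1 =
    (pi * (c + a * d) / (c * d * ((c + a * d) ^+ 2 + a ^+ 2 * b ^+ 2)))%:E.
Proof.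
rewrite le_eqVlt => /predU1P[<-|a0] c0 d0.
  rewrite integral11_a0//; congr EFin; field.
  by rewrite !gt_eqF.
have [deg|] := eqVneq ((c - a * d) ^+ 2 + a ^+ 2 * b ^+ 2) 0; last first.
  exact: integral11_nondegenerate.
move/eqP: deg; rewrite -exprMn paddr_eq0 ?sqr_ge0// !sqrf_eq0 subr_eq0.
rewrite mulf_eq0 (gt_eqF a0)/= => /andP[/eqP-> /eqP->].
rewrite integral11_degenerate//; congr EFin; field.
by have ad0 := mulr_gt0 a0 d0; rewrite !gt_eqF// addr_gt0.
Qed.

End base_case.

(** * Dependence on the parameters *)

Section power_integrals.
Context {R : realType}.
Notation mu := (@lebesgue_measure R).
Variables w A0 : R -> R.
Hypothesis w0 : forall x, 0 <= w x.
Hypothesis A00 : forall x, 0 <= A0 x.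
Hypothesis cw : continuous w.
Hypothesis cA0 : continuous A0.
Hypothesis intw : forall s : R, 0 < s ->
  mu.-integrable setT (EFin \o (fun x => w x * (A0 x + s) ^- 1)).

Let As_gt0 (s x : R) : 0 < s -> 0 < A0 x + s.
Proof. by move=> s0; rewrite ltr_wpDl. Qed.

Lemma measurable_pow_quot m (s : R) : 0 < s ->
  measurable_fun setT (fun x => w x * (A0 x + s) ^- m).
Proof.
move=> s0; apply: continuous_measurable_fun => x.
apply: cvgM; first exact: cw.
apply: cvgV; first by rewrite expf_neq0// gt_eqF// As_gt0.
apply: (continuous_comp (f := fun x => A0 x + s) (g := fun y : R => y ^+ m)).
  by apply: cvgD; [exact: cA0|exact: cvg_cst].
exact: exprn_continuous.
Qed.

(** Since [A0 x + s >= s], every further negative power costs at most a factor [s^-1], so the case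
    of exponent 1 dominates. *)
Lemma integrable_pow_quot m (s : R) : 0 < s -> (0 < m)%N ->
  mu.-integrable setT (EFin \o (fun x => w x * (A0 x + s) ^- m)).
Proof.
case: m => // m s0 _.
apply: (@le_integrable _ _ _ mu setT measurableT _
   (EFin \o (fun x => s ^- m * (w x * (A0 x + s) ^- 1)))).
- by apply/measurable_EFinP; exact: measurable_pow_quot.
- move=> x _; rewrite /= lee_fin.
  have h := As_gt0 x s0; have h1 : 0 < (A0 x + s)^-1 by rewrite invr_gt0.
  rewrite !ger0_norm ?mulr_ge0 ?invr_ge0 ?exprn_ge0 ?(ltW h) ?(ltW s0)//.
  rewrite mulrCA ler_wpM2l// exprS invfM mulrC expr1 ler_wpM2r//; first exact: ltW.
  by rewrite lef_pV2 ?posrE ?exprn_gt0// lerXn2r ?nnegrE ?(ltW s0) ?(ltW h)// lerDr.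
- exact: (integrableZl measurableT (s ^- m) (intw s0)).
Qed.

Let is_derive_pow_quot0 m (c x : R) : 0 < c -> (0 < m)%N ->
  is_derive c 1 (fun c : R => w x * (A0 x + c ^+ 2) ^- m)
    (- (2 * m%:R * c) * (w x * (A0 x + c ^+ 2) ^- m.+1)).
Proof.
case: m => // m c0 _.
have h : A0 x + c ^+ 2 != 0 by rewrite gt_eqF// As_gt0// exprn_gt0.
have hm : (A0 x + c ^+ 2) ^+ m.+1 != 0 by rewrite expf_neq0.
have dA : is_derive c 1 (fun c : R => A0 x + c ^+ 2) (2 * c).
  by apply: is_derive_eq; rewrite /GRing.scale/=; lra.
have dX := is_derive1_expn m.+1 dA.
have dV := @is_deriveV _ (fun c : R => (A0 x + c ^+ 2) ^+ m.+1) c _ _ hm dX.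
have -> : - (2 * m.+1%:R * c) * (w x * (A0 x + c ^+ 2) ^- m.+2) =
  w x *: (- (A0 x + c ^+ 2) ^+ m.+1 ^- 2 *: (m.+1%:R * (A0 x + c ^+ 2) ^+ m * (2 * c))).
  rewrite /GRing.scale/=; move: h; set A := A0 x + _ => h.
  by rewrite !exprS; field; rewrite expf_neq0 ?h.
exact: (is_deriveZ (w x) dV).
Qed.

(** Differentiation under the integral sign. It is applied twice, with the two quadratics exchanging
    roles: a negative power of one is the weight [w], the other is [A0 + c^2]. *)
Lemma is_derive_pow_quot m (c : R) : 0 < c -> (0 < m)%N ->
  is_derive c 1 (fun c : R => \int[mu]_x (w x * (A0 x + c ^+ 2) ^- m))
    (- (2 * m%:R * c) * \int[mu]_x (w x * (A0 x + c ^+ 2) ^- m.+1)).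
Proof.
move=> c0 m0.
pose f (c x : R) := w x * (A0 x + c ^+ 2) ^- m.
have Ic : `]c / 2, (2 * c)[%classic c by rewrite /= in_itv/=; lra.
have Ipos e : `]c / 2, (2 * c)[%classic e -> 0 < e.
  by rewrite /= in_itv/= => /andP[h _]; apply: lt_trans h; lra.
have fI e : `]c / 2, (2 * c)[%classic e -> mu.-integrable setT (EFin \o f e).
  by move=> /Ipos e0; apply: integrable_pow_quot => //; rewrite exprn_gt0.
have fd e y : `]c / 2, (2 * c)[%classic e -> setT y -> derivable (f ^~ y) e 1.
  by move=> /Ipos e0 _; have [] := is_derive_pow_quot0 y e0 m0.
have fE e y : 0 < e -> (f ^~ y)^`()%classic e =
    - (2 * m%:R * e) * (w y * (A0 y + e ^+ 2) ^- m.+1).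
  by move=> e0; rewrite derive1E; have [_ ->] := is_derive_pow_quot0 y e0 m0.
(* The worst case of the derivative on the window ]c/2, 2c[: the upper end in the prefactor, the
   lower end in the denominator. *)
pose G x := (2 * m%:R * (2 * c)) * (w x * (A0 x + (c / 2) ^+ 2) ^- m.+1).
have c2 : 0 < (c / 2) ^+ 2 by rewrite exprn_gt0// divr_gt0.
have G0 y : 0 <= G y.
  rewrite /G !mulr_ge0 ?(ltW c0)// invr_ge0 exprn_ge0// ltW// As_gt0//.
have iG : mu.-integrable setT (EFin \o G).
  apply: (integrableZl measurableT (2 * m%:R * (2 * c))
    (integrable_pow_quot c2 _)) => //.
have Gub e y : `]c / 2, (2 * c)[%classic e -> setT y ->
    `|partial1of2 f e y| <= G y.
  move=> Ie _; have e0 := Ipos _ Ie; move: Ie; rewrite /= in_itv/= => /andP[e1 e2].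
  rewrite /partial1of2 fE// normrM normrN !normrM !normr_nat (gtr0_norm e0).
  rewrite (ger0_norm (w0 y)) ger0_norm; last first.
    by rewrite invr_ge0 exprn_ge0// ltW// As_gt0// exprn_gt0.
  have hA : 0 < A0 y + (c / 2) ^+ 2 by rewrite As_gt0.
  have hB : 0 < A0 y + e ^+ 2 by rewrite As_gt0// exprn_gt0.
  rewrite /G ler_pM ?mulr_ge0 ?invr_ge0 ?exprn_ge0 ?(ltW e0) ?(ltW hB)//.
    by rewrite ler_wpM2l ?mulr_ge0// ltW.
  rewrite ler_wpM2l// lef_pV2 ?posrE ?exprn_gt0//.
  rewrite lerXn2r ?nnegrE ?(ltW hA) ?(ltW hB)// lerD2l.
  by rewrite lerXn2r ?nnegrE ?(ltW e0) ?divr_ge0 ?(ltW c0) ?(ltW e1).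
have D1 := derivable_under_integral measurableT Ic fI fd G0 iG Gub.
have D2 := differentiation_under_integral measurableT Ic fI fd G0 iG Gub.
apply: DeriveDef; first exact: D1.
rewrite -derive1E D2 /= -RintegralZl//; last first.
  by apply: integrable_pow_quot => //; rewrite exprn_gt0.
by apply: eq_Rintegral => x _; rewrite /partial1of2 fE.
Qed.

Let le_mixed_quot N (s t x : R) : 0 < s -> 0 < t ->
  0 <= w x * (A0 x + s) ^- N * (A0 x + t) ^- 1 <= s ^- N * (w x * (A0 x + t) ^- 1).
Proof.
move=> s0 t0; have hs := As_gt0 x s0; have ht := As_gt0 x t0.
rewrite !mulr_ge0 ?invr_ge0 ?exprn_ge0 ?(ltW hs) ?(ltW ht)//=.
rewrite -mulrA mulrCA ler_wpM2r//.
  by rewrite mulr_ge0 ?invr_ge0 ?exprn_ge0 ?(ltW ht).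
by rewrite lef_pV2 ?posrE ?exprn_gt0// lerXn2r ?nnegrE ?(ltW s0) ?(ltW hs)// lerDr.
Qed.

Let integrable_mixed_quot N (s t : R) : 0 < s -> 0 < t ->
  mu.-integrable setT
    (EFin \o (fun x => w x * (A0 x + s) ^- N * (A0 x + t) ^- 1)).
Proof.
move=> s0 t0.
apply: (@le_integrable _ _ _ mu setT measurableT _
   (EFin \o (fun x => s ^- N * (w x * (A0 x + t) ^- 1)))).
- apply/measurable_EFinP; apply: measurable_funM.
    exact: measurable_pow_quot.
  apply: continuous_measurable_fun => x.
  apply: cvgV; first by rewrite expr1 gt_eqF// As_gt0.
  by apply: cvgD; [exact: cA0|exact: cvg_cst].
- move=> x _; rewrite /= lee_fin.
  have /andP[h1 h2] := le_mixed_quot N x s0 t0.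
  by rewrite !ger0_norm// (le_trans h1 h2).
- exact: (integrableZl measurableT (s ^- N) (intw t0)).
Qed.

(** The geometric series of 1 / (A - z), for A = [A0 + s], is summed under the integral without a
    limit theorem for integrals: the remainder after N terms is exactly [z ^+ N.+1 * T N], and [T N]
    is at most [s ^- N * T 0]. *)
Lemma cvg_series_pow_quot (s z : R) : `|z| < s ->
  series (fun n => (\int[mu]_x (w x * (A0 x + s) ^- n.+1)) * z ^+ n.+1) @ \oo -->
  z * \int[mu]_x (w x * (A0 x + (s - z)) ^- 1).
Proof.
move=> zs.
have s0 : 0 < s by exact: le_lt_trans zs.
have t0 : 0 < s - z by rewrite subr_gt0; apply: le_lt_trans zs; exact: ler_norm.
(* T N is the remainder of the geometric series of 1 / (A0 + (s - z)). *)
pose T N := \int[mu]_x (w x * (A0 x + s) ^- N * (A0 x + (s - z)) ^- 1).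
pose I n := \int[mu]_x (w x * (A0 x + s) ^- n.+1).
have TS N : T N = I N + z * T N.+1.
  rewrite /T /I -RintegralZl//; last exact: integrable_mixed_quot.
  rewrite -RintegralD//; first last.
  - exact: (integrableZl measurableT z (integrable_mixed_quot _ s0 t0)).
  - exact: integrable_pow_quot.
  apply: eq_Rintegral => x _ /=.
  have hs := As_gt0 x s0; have := As_gt0 x t0.
  rewrite addrA => ht; rewrite !exprS !expr0; field.
  by rewrite !gt_eqF ?exprn_gt0.
have ST N : z * T 0 - series (fun n => I n * z ^+ n.+1) N = z ^+ N.+1 * T N.
  elim: N => [|N IH]; first by rewrite /series/= big_geq// subr0 expr1.
  rewrite /series/= big_nat_recr//= opprD addrA -/(series _ N) IH TS.
  by rewrite !exprS; ring.
have T0 : T 0%N = \int[mu]_x (w x * (A0 x + (s - z)) ^- 1).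
  by apply: eq_Rintegral => x _; rewrite expr0 invr1 mulr1.
rewrite -T0.
have TB N : `|z ^+ N.+1 * T N| <= `|z| * T 0%N * (`|z| / s) ^+ N.
  have TN0 : 0 <= T N.
    by apply: Rintegral_ge0 => x _; have /andP[] := le_mixed_quot N x s0 t0.
  rewrite normrM normrX (ger0_norm TN0) expr_div_n exprS.
  rewrite -!mulrA ler_wpM2l// [leRHS]mulrCA ler_wpM2l// mulrC -RintegralZl//.
  - apply: le_Rintegral => //.
    + exact: integrable_mixed_quot.
    + exact: (integrableZl measurableT (s ^- N) (integrable_mixed_quot 0 s0 t0)).
    + move=> x _; have /andP[_] := le_mixed_quot N x s0 t0.
      by rewrite expr0 invr1 mulr1.
  - exact: integrable_mixed_quot.
have geo : `|z| * T 0%N * (`|z| / s) ^+ N @[N --> \oo] --> (0 : R).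
  apply: (@cvg_geometric R (`|z| * T 0%N) (`|z| / s)).
  rewrite ger0_norm; last by rewrite divr_ge0// ltW.
  by rewrite ltr_pdivrMr// mul1r.
apply/cvgrPdist_le => e e0; near=> N.
rewrite ST (le_trans (TB N))// (le_trans (ler_norm _))//.
by near: N; exact: (cvgr0_norm_le _ geo).
Unshelve. all: by end_near. Qed.

End power_integrals.

(** Real-valued counterpart of [integral_mn], to which derivatives and series apply; [integral_mnE]
    identifies the two once integrability is known. *)
Definition Jint {R : realType} (a b c d : R) (m n : nat) : R :=
  \int[lebesgue_measure]_x
    ((a ^+ 2 * (x - b) ^+ 2 + c ^+ 2) ^- m * (x ^+ 2 + d ^+ 2) ^- n).

Section Jint.
Context {R : realType}.
Notation mu := (@lebesgue_measure R).
Implicit Types a b c d s x y z : R.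

Let integrable11 a b c d : 0 <= a -> 0 < c -> 0 < d ->
  mu.-integrable setT (EFin \o (fun x : R =>
    (a ^+ 2 * (x - b) ^+ 2 + c ^+ 2) ^- 1 * (x ^+ 2 + d ^+ 2) ^- 1)).
Proof.
move=> a0 c0 d0; apply/integrableP; split.
  apply/measurable_EFinP; apply: continuous_measurable_fun.
  exact: continuous_integrand.
under eq_integral => x _ do rewrite /= ger0_norm ?integrand_ge0//.
by rewrite -/(integral_mn a b c d 1 1) integral11// ltry.
Qed.

Let le_integrand a b c d m n x : 0 < c -> 0 < d ->
  (a ^+ 2 * (x - b) ^+ 2 + c ^+ 2) ^- m.+1 * (x ^+ 2 + d ^+ 2) ^- n.+1 <=
  (c ^+ 2) ^- m * (d ^+ 2) ^- n *
    ((a ^+ 2 * (x - b) ^+ 2 + c ^+ 2) ^- 1 * (x ^+ 2 + d ^+ 2) ^- 1).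
Proof.
move=> c0 d0; have hA := quad_gt0 a b x c0; have hB := sqrD_gt0 x d0.
have hc : 0 < c ^+ 2 by rewrite exprn_gt0.
have hd : 0 < d ^+ 2 by rewrite exprn_gt0.
have cA : c ^+ 2 <= a ^+ 2 * (x - b) ^+ 2 + c ^+ 2 by rewrite lerDr -exprMn sqr_ge0.
have dB : d ^+ 2 <= x ^+ 2 + d ^+ 2 by rewrite lerDr sqr_ge0.
move: hA hB hc hd cA dB.
set A := _ + c ^+ 2; set B := x ^+ 2 + _; move: (c ^+ 2) (d ^+ 2) => c2 d2.
move=> hA hB hc hd cA dB.
rewrite [leRHS]mulrACA !expr1 (exprS A) (exprS B) !invfM.
have step (u v : R) k : 0 < u -> u <= v -> v^-1 * v ^- k <= u ^- k * v^-1.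
  move=> u0 uv; have v0 := lt_le_trans u0 uv.
  rewrite mulrC ler_wpM2r ?invr_ge0 ?(ltW v0)// lef_pV2 ?posrE ?exprn_gt0//.
  by rewrite lerXn2r ?nnegrE ?(ltW u0) ?(ltW v0).
rewrite ler_pM ?mulr_ge0 ?invr_ge0 ?exprn_ge0 ?(ltW hA) ?(ltW hB)//.
  exact: step.
exact: step.
Qed.

Lemma integrable_integrand a b c d m n :
  (0 < m)%N -> (0 < n)%N -> 0 <= a -> 0 < c -> 0 < d ->
  mu.-integrable setT (EFin \o (fun x : R =>
    (a ^+ 2 * (x - b) ^+ 2 + c ^+ 2) ^- m * (x ^+ 2 + d ^+ 2) ^- n)).
Proof.
case: m n => // m [//|n] _ _ a0 c0 d0.
apply: (@le_integrable _ _ _ mu setT measurableT _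
   (EFin \o (fun x => (c ^+ 2) ^- m * (d ^+ 2) ^- n *
    ((a ^+ 2 * (x - b) ^+ 2 + c ^+ 2) ^- 1 * (x ^+ 2 + d ^+ 2) ^- 1)))).
- apply/measurable_EFinP; apply: continuous_measurable_fun.
  exact: continuous_integrand.
- move=> x _; rewrite /= lee_fin ger0_norm ?integrand_ge0//.
  by rewrite (le_trans (le_integrand a b m n x c0 d0))// ler_norm.
- exact: (integrableZl measurableT _ (integrable11 b a0 c0 d0)).
Qed.

Lemma integral_mnE a b c d m n :
  (0 < m)%N -> (0 < n)%N -> 0 <= a -> 0 < c -> 0 < d ->
  integral_mn a b c d m n = (Jint a b c d m n)%:E.
Proof.
move=> m0 n0 a0 c0 d0; rewrite /Jint /Rintegral fineK//.
by apply: integrable_fin_num => //; exact: integrable_integrand.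
Qed.

Lemma Jint11 a b c d : 0 <= a -> 0 < c -> 0 < d -> Jint a b c d 1 1 =
  pi * (c + a * d) / (c * d * ((c + a * d) ^+ 2 + a ^+ 2 * b ^+ 2)).
Proof.
by move=> a0 c0 d0; have := integral11 b a0 c0 d0; rewrite integral_mnE// => -[].
Qed.

Lemma Jint_ge0 a b c d m n : 0 < c -> 0 < d -> 0 <= Jint a b c d m n.
Proof. by move=> c0 d0; apply: Rintegral_ge0 => x _; exact: integrand_ge0. Qed.

(** Provides the geometric majorant of the double series in y and z. *)
Lemma Jint_le a b c d m n : 0 <= a -> 0 < c -> 0 < d ->
  Jint a b c d m.+1 n.+1 <= (c ^+ 2) ^- m * (d ^+ 2) ^- n * Jint a b c d 1 1.
Proof.
move=> a0 c0 d0; rewrite /Jint -RintegralZl//; last exact: integrable11.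
apply: le_Rintegral => //; first exact: integrable_integrand.
  exact: (integrableZl measurableT _ (integrable11 b a0 c0 d0)).
by move=> x _; exact: le_integrand.
Qed.

Let continuous_A0 a b : continuous (fun x : R => a ^+ 2 * (x - b) ^+ 2).
Proof.
move=> x; apply: differentiable_continuous; apply/derivable1_diffP.
exact: ex_derive.
Qed.

Let continuous_B0 : continuous (fun x : R => x ^+ 2).
Proof. by move=> x; exact: exprn_continuous. Qed.

Let continuous_Apow a b c m : 0 < c ->
  continuous (fun x : R => (a ^+ 2 * (x - b) ^+ 2 + c ^+ 2) ^- m).
Proof.
move=> c0 x; have := @continuous_integrand R a b c c m 0 c0 c0 x.
by under eq_fun do rewrite expr0 invr1 mulr1.
Qed.

Let continuous_Bpow d n : 0 < d -> continuous (fun x : R => (x ^+ 2 + d ^+ 2) ^- n).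
Proof.
move=> d0 x; have := @continuous_integrand R 0 0 d d 0 n d0 d0 x.
by under eq_fun do rewrite expr0 invr1 mul1r.
Qed.

Let Apow_ge0 a b c m x : 0 < c -> 0 <= (a ^+ 2 * (x - b) ^+ 2 + c ^+ 2) ^- m.
Proof. by move=> c0; rewrite invr_ge0 exprn_ge0// ltW// quad_gt0. Qed.

Let Bpow_ge0 d n x : 0 < d -> 0 <= (x ^+ 2 + d ^+ 2) ^- n.
Proof. by move=> d0; rewrite invr_ge0 exprn_ge0// ltW// sqrD_gt0. Qed.

Let intA a b d n s : (0 < n)%N -> 0 <= a -> 0 < d -> 0 < s ->
  mu.-integrable setT (EFin \o (fun x : R =>
    (x ^+ 2 + d ^+ 2) ^- n * (a ^+ 2 * (x - b) ^+ 2 + s) ^- 1)).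
Proof.
move=> n0 a0 d0 s0; have := @integrable_integrand a b (Num.sqrt s) d 1 n.
rewrite sqr_sqrtr ?(ltW s0)// sqrtr_gt0; under eq_fun do rewrite mulrC.
exact.
Qed.

Let intB a b c m s : (0 < m)%N -> 0 <= a -> 0 < c -> 0 < s ->
  mu.-integrable setT (EFin \o (fun x : R =>
    (a ^+ 2 * (x - b) ^+ 2 + c ^+ 2) ^- m * (x ^+ 2 + s) ^- 1)).
Proof.
move=> m0 a0 c0 s0; have := @integrable_integrand a b c (Num.sqrt s) m 1.
by rewrite sqr_sqrtr ?(ltW s0)// sqrtr_gt0; exact.
Qed.

Lemma is_derive_Jint_c a b c d m n :
  (0 < m)%N -> (0 < n)%N -> 0 <= a -> 0 < c -> 0 < d ->
  is_derive c 1 (fun c => Jint a b c d m n)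
    (- (2 * m%:R * c) * Jint a b c d m.+1 n).
Proof.
move=> m0 n0 a0 c0 d0.
have := is_derive_pow_quot (fun x => Bpow_ge0 n x d0)
  (fun x => mulr_ge0 (sqr_ge0 a) (sqr_ge0 (x - b))) (continuous_Bpow (n := n) d0)
  (continuous_A0 (a := a) (b := b)) (fun s => @intA a b d n s n0 a0 d0) c0 m0.
have JE c' m' : \int[mu]_x ((x ^+ 2 + d ^+ 2) ^- n *
    (a ^+ 2 * (x - b) ^+ 2 + c' ^+ 2) ^- m') = Jint a b c' d m' n.
  by apply: eq_Rintegral => x _; rewrite mulrC.
by rewrite JE; under eq_fun do rewrite JE.
Qed.

Lemma is_derive_Jint_d a b c d m n :
  (0 < m)%N -> (0 < n)%N -> 0 <= a -> 0 < c -> 0 < d ->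
  is_derive d 1 (fun d => Jint a b c d m n)
    (- (2 * n%:R * d) * Jint a b c d m n.+1).
Proof.
move=> m0 n0 a0 c0 d0.
exact: (is_derive_pow_quot (fun x => Apow_ge0 a b m x c0)
  (fun x => sqr_ge0 x) (continuous_Apow (m := m) (a := a) (b := b) c0)
  continuous_B0 (fun s => @intB a b c m s m0 a0 c0) d0 n0).
Qed.

Lemma cvg_series_Jint_c a b c d n y :
  (0 < n)%N -> 0 <= a -> 0 < c -> 0 < d -> `|y| < c ^+ 2 ->
  series (fun m => Jint a b c d m.+1 n * y ^+ m.+1) @ \oo -->
  y * Jint a b (Num.sqrt (c ^+ 2 - y)) d 1 n.
Proof.
move=> n0 a0 c0 d0 yc.
have := cvg_series_pow_quot (fun x => Bpow_ge0 n x d0)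
  (fun x => mulr_ge0 (sqr_ge0 a) (sqr_ge0 (x - b))) (continuous_Bpow (n := n) d0)
  (continuous_A0 (a := a) (b := b)) (fun s => @intA a b d n s n0 a0 d0) yc.
have JE c' m' : \int[mu]_x ((x ^+ 2 + d ^+ 2) ^- n *
    (a ^+ 2 * (x - b) ^+ 2 + c' ^+ 2) ^- m') = Jint a b c' d m' n.
  by apply: eq_Rintegral => x _; rewrite mulrC.
have cy : 0 <= c ^+ 2 - y by rewrite subr_ge0 (le_trans (ler_norm _))// ltW.
rewrite -[c ^+ 2 - y in X in X -> _](sqr_sqrtr cy) JE.
by under [in X in X -> _]eq_fun do rewrite JE.
Qed.

Lemma cvg_series_Jint_d a b c d m z :
  (0 < m)%N -> 0 <= a -> 0 < c -> 0 < d -> `|z| < d ^+ 2 ->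
  series (fun n => Jint a b c d m n.+1 * z ^+ n.+1) @ \oo -->
  z * Jint a b c (Num.sqrt (d ^+ 2 - z)) m 1.
Proof.
move=> m0 a0 c0 d0 zd.
have dz : 0 <= d ^+ 2 - z by rewrite subr_ge0 (le_trans (ler_norm _))// ltW.
rewrite {2}/Jint sqr_sqrtr//.
exact: (cvg_series_pow_quot (fun x => Apow_ge0 a b m x c0)
  (fun x => sqr_ge0 x) (continuous_Apow (m := m) (a := a) (b := b) c0)
  continuous_B0 (fun s => @intB a b c m s m0 a0 c0) zd).
Qed.

End Jint.

(** * Unconditional summation *)

Section has_sum_theory.
Context {R : realType}.

(** Trades the filter on finite sets for duplicate-free sequences, on which iterated sums are easier
    to reindex. *)
Lemma has_sumP {T : choiceType} (f : T -> R) (s : R) :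
  has_sum f s <-> forall e : R, 0 < e -> exists r0 : seq T, forall r : seq T,
    uniq r -> {subset r0 <= r} -> `|s - \sum_(i <- r) f i| <= e.
Proof.
have pE (A : {fset T}) : summability.partial_sum f A = \sum_(i <- A) f i.
  by rewrite /summability.partial_sum big_seq_fsetE.
have totally_filter := @summability.totally_filter T.
split => [fs e e0|fs].
  have /cvgrPdist_le/(_ e e0)[A _ HA] := fs.
  exists (enum_fset A) => r ur Ar.
  have := HA [fset x in r]%fset; rewrite /= pE => /(_ _)/wrap[].
    by apply/fsubsetP => x xA; rewrite in_fset; exact: Ar.
  rewrite (perm_big r)//; apply: uniq_perm => //.
  by move=> x; rewrite in_fset.
apply/cvgrPdist_le => e e0; have [r0 Hr] := fs e e0.
exists [fset x in r0]%fset => // B /fsubsetP r0B; rewrite pE; apply: Hr => //.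
by move=> x xr0; apply: r0B; rewrite in_fset.
Qed.

Lemma has_sum_unique {T : choiceType} (f : T -> R) (s t : R) :
  has_sum f s -> has_sum f t -> s = t.
Proof.
move=> fs ft; have := @summability.totally_filter T => ?.
exact: (cvg_unique _ fs ft).
Qed.

Lemma has_sum_finsupp {T : choiceType} (f : T -> R) (r0 : seq T) :
  uniq r0 -> (forall i, i \notin r0 -> f i = 0) ->
  has_sum f (\sum_(i <- r0) f i).
Proof.
move=> ur0 f0; apply/has_sumP => e e0; exists r0 => r ur r0r.
suff -> : \sum_(i <- r) f i = \sum_(i <- r0) f i by rewrite subrr normr0 ltW.
rewrite (bigID (mem r0))/= addrC big1_seq ?add0r//; last first.
  by move=> i /andP[/f0].
rewrite -big_filter; apply: perm_big; apply: uniq_perm => //.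
  exact: filter_uniq.
by move=> x; rewrite mem_filter; case: (boolP (x \in r0)) => // /r0r ->.
Qed.

Lemma has_sumD {T : choiceType} (f g : T -> R) (s t : R) :
  has_sum f s -> has_sum g t -> has_sum (fun i => f i + g i) (s + t).
Proof.
move=> fs gt; have ? := @summability.totally_filter T.
rewrite /has_sum (_ : summability.partial_sum _ =
  fun A => summability.partial_sum f A + summability.partial_sum g A).
  exact: cvgD fs gt.
by apply/funext => A; rewrite /summability.partial_sum big_split.
Qed.

Lemma has_sumZ {T : choiceType} (f : T -> R) (k s : R) :
  has_sum f s -> has_sum (fun i => k * f i) (k * s).
Proof.
move=> fs; have ? := @summability.totally_filter T.
rewrite /has_sum (_ : summability.partial_sum _ =
  fun A => k * summability.partial_sum f A).
  exact: cvgMl_tmp fs.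
by apply/funext => A; rewrite /summability.partial_sum mulr_sumr.
Qed.

Definition abs_summable {T : choiceType} (f : T -> R) : Prop :=
  exists M : R, forall r : seq T, uniq r -> \sum_(i <- r) `|f i| <= M.

Lemma abs_summable_le {T : choiceType} (f g : T -> R) :
  (forall i, `|f i| <= `|g i|) -> abs_summable g -> abs_summable f.
Proof.
move=> fg [M HM]; exists M => r ur; apply: le_trans (HM r ur).
by apply: ler_sum => i _; exact: fg.
Qed.

Let ge0_has_sum {T : choiceType} (f : T -> R) :
  (forall i, 0 <= f i) -> abs_summable f -> exists s, has_sum f s.
Proof.
move=> f0 [M HM].
pose S : set R := [set x | exists2 r : seq T, uniq r & x = \sum_(i <- r) f i].
have S0 : S !=set0 by exists 0; exists [::]; rewrite ?big_nil.
have Sub : has_ubound S.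
  exists M => x [r ur ->]; apply: le_trans (HM r ur).
  by apply: ler_sum => i _; exact: ler_norm.
exists (sup S); apply/has_sumP => e e0.
have [x [r0 ur0 ->] xe] := sup_adherent e0 (conj S0 Sub).
exists r0 => r ur r0r.
have le1 : \sum_(i <- r) f i <= sup S by apply: ub_le_sup => //; exists r.
rewrite ger0_norm ?subr_ge0// lerBlDr -lerBlDl; apply: le_trans (ltW xe) _.
rewrite [leRHS](bigID (mem r0))/= -[leLHS]addr0 lerD ?sumr_ge0//.
rewrite -[leRHS]big_filter (perm_big [seq x <- r | x \in r0])//.
apply: uniq_perm => //; first exact: filter_uniq.
by move=> y; rewrite mem_filter; case: (boolP (y \in r0)) => // /r0r ->.
Qed.

(** Positive and negative parts are both dominated by the absolute value, and a nonnegative bounded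
    family sums to the supremum of its finite sums. *)
Lemma abs_summable_has_sum {T : choiceType} (f : T -> R) :
  abs_summable f -> exists s, has_sum f s.
Proof.
move=> fM.
have f1 i : f i <= `|f i| by exact: ler_norm.
have f2 i : - f i <= `|f i| by rewrite -normrN; exact: ler_norm.
have [s Hs] : exists s, has_sum (fun i => (`|f i| + f i) / 2) s.
  apply: ge0_has_sum => [i|]; first by have := f2 i; lra.
  apply: abs_summable_le fM => i; have ? := f1 i; have ? := f2 i.
  by rewrite ler_norml; apply/andP; split; lra.
have [t Ht] : exists s, has_sum (fun i => (`|f i| - f i) / 2) s.
  apply: ge0_has_sum => [i|]; first by have := f1 i; lra.
  apply: abs_summable_le fM => i; have ? := f1 i; have ? := f2 i.
  by rewrite ler_norml; apply/andP; split; lra.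
exists (s + -1 * t).
have -> : f = fun i => (`|f i| + f i) / 2 + -1 * ((`|f i| - f i) / 2).
  by apply/funext => i; field.
exact: has_sumD Hs (has_sumZ Ht).
Qed.

(** A finite set of rows is compared with a finite rectangle that contains the indices needed for
    the total and approximates each of its rows. Unconditional convergence of the whole family is
    enough for this. *)
Lemma has_sum_rows {I J : choiceType} (f : I * J -> R) (g : I -> R) (s : R) :
  has_sum f s -> (forall i, has_sum (fun j => f (i, j)) (g i)) -> has_sum g s.
Proof.
move=> /has_sumP fs fg; apply/has_sumP => e e0.
have e2 : 0 < e / 2 by rewrite divr_gt0.
have [r0 Hr0] := fs _ e2.
exists (map fst r0) => r ur r0r.
(* The error e/2 is shared among the rows in [r]; the successor keeps the denominator positive when
   [r] is empty. *)
pose d := e / 2 / (size r).+1%:R.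
have d0 : 0 < d by rewrite divr_gt0.
have /choice[q Hq] i : exists q : seq J, forall r : seq J,
    uniq r -> {subset q <= r} -> `|g i - \sum_(j <- r) f (i, j)| <= d.
  by have /has_sumP/(_ d d0) := fg i.
(* One set of columns for all rows: it contains the columns of [r0], so that the rectangle [r] times
   [t] covers [r0], and the columns [q i] of each row. *)
pose t := undup (map snd r0 ++ flatten [seq q i | i <- r]).
have -> : s - \sum_(i <- r) g i = (s - \sum_(i <- r) \sum_(j <- t) f (i, j)) +
    \sum_(i <- r) (\sum_(j <- t) f (i, j) - g i).
  by rewrite sumrB; lra.
rewrite (le_trans (ler_normD _ _))// (_ : e = e / 2 + e / 2); last by lra.
apply: lerD.
  rewrite -(big_allpairs_dep (h := pair) (r2 := fun=> t) (F := f)).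
  apply: Hr0.
    by apply: allpairs_uniq => //; [exact: undup_uniq|move=> [? ?] [? ?]].
  move=> [i j] ij; apply/allpairsP; exists (i, j); split => //=.
    by apply: r0r; apply/mapP; exists (i, j).
  by rewrite mem_undup mem_cat; apply/orP; left; apply/mapP; exists (i, j).
rewrite (le_trans (ler_norm_sum _ _ _))//.
apply: (@le_trans _ _ (\sum_(i <- r) d)).
  rewrite big_seq [leRHS]big_seq; apply: ler_sum => i ir.
  rewrite distrC; apply: Hq; first exact: undup_uniq.
  move=> j jq; rewrite mem_undup mem_cat; apply/orP; right.
  by apply/flattenP; exists (q i) => //; apply: map_f.
rewrite big_const_seq count_predT iter_addr_0 -[leLHS]mulr_natr /d.
rewrite -[leLHS]mulrA ler_piMr ?(ltW e2)//.
by rewrite mulrC ler_pdivrMr// mul1r ler_nat.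
Qed.

Lemma has_sum_bij {T T' : choiceType} (h : T' -> T) (h' : T -> T')
    (f : T -> R) (s : R) :
  cancel h h' -> cancel h' h -> has_sum f s -> has_sum (f \o h) s.
Proof.
move=> hK h'K /has_sumP fs; apply/has_sumP => e /fs[r0 Hr].
exists (map h' r0) => r ur r0r.
have := Hr (map h r); rewrite big_map; apply.
  by rewrite map_inj_uniq//; exact: can_inj hK.
by move=> x xr0; apply/mapP; exists (h' x) => //; apply: r0r; exact: map_f.
Qed.

Lemma has_sum_series (f : nat -> R) (s : R) : has_sum f s -> series f @ \oo --> s.
Proof.
move=> /has_sumP fs; apply/cvgrPdist_le => e /fs[r0 Hr].
exists (\max_(i <- r0) i).+1 => // n /= Mn; rewrite /series/=.
apply: Hr; first exact: iota_uniq.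
move=> i ir; rewrite mem_index_iota/=; apply: leq_trans Mn.
by rewrite ltnS (big_rem i ir)/= leq_maxl.
Qed.

Lemma has_sum_of_series (f : nat -> R) (s : R) :
  abs_summable f -> series f @ \oo --> s -> has_sum f s.
Proof.
move=> /abs_summable_has_sum[t ft] fs.
by rewrite (cvg_unique _ fs (has_sum_series ft)).
Qed.

Lemma abs_summable_row {I J : choiceType} (f : I * J -> R) i :
  abs_summable f -> abs_summable (fun j => f (i, j)).
Proof.
move=> [M HM]; exists M => r ur.
have := HM [seq (i, j) | j <- r]; rewrite big_map; apply.
by rewrite map_inj_uniq// => x y [].
Qed.

Lemma abs_summable_bij {T T' : choiceType} (h : T' -> T) (f : T -> R) :
  injective h -> abs_summable f -> abs_summable (f \o h).
Proof.
move=> hI [M HM]; exists M => r ur.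
by have := HM (map h r); rewrite big_map; apply; rewrite map_inj_uniq.
Qed.

(** A finite set of pairs lies in the rectangle spanned by its two projections, over which the sum
    factors. *)
Lemma abs_summable_prod {I J : choiceType} (g : I -> R) (h : J -> R) :
  abs_summable g -> abs_summable h -> abs_summable (fun p => g p.1 * h p.2).
Proof.
move=> [M HM] [N HN]; exists (M * N) => r ur.
pose r1 := undup (map fst r); pose r2 := undup (map snd r).
apply: (@le_trans _ _ (\sum_(i <- r1) \sum_(j <- r2) `|g i * h j|)).
  rewrite -(big_allpairs_dep (h := pair) (r2 := fun=> r2)
    (F := fun p => `|g p.1 * h p.2|)).
  rewrite [leRHS](bigID (mem r))/= -[leLHS]addr0 lerD ?sumr_ge0//.
  rewrite -[leRHS]big_filter.
  rewrite (perm_big [seq p <- [seq (i, j) | i <- r1, j <- r2] | p \in r])//.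
  apply: uniq_perm => //.
    rewrite filter_uniq//.
    by apply: allpairs_uniq; rewrite ?undup_uniq// => -[? ?] [? ?].
  move=> [i j]; rewrite mem_filter; case: (boolP (_ \in r)) => //= ij.
  by apply/esym/allpairsP; exists (i, j); rewrite /r1 /r2 !mem_undup; split=> //;
    apply/mapP; exists (i, j).
under eq_bigr do under eq_bigr do rewrite normrM.
under eq_bigr do rewrite -mulr_sumr.
rewrite -mulr_suml ler_pM ?sumr_ge0 ?HM ?HN ?undup_uniq//.
Qed.

Lemma abs_summable_geometric (q : R) : 0 <= q < 1 -> abs_summable (fun n => q ^+ n).
Proof.
move=> /andP[q0 q1]; exists (1 - q)^-1 => r ur.
have q1' : 0 < 1 - q by rewrite subr_gt0.
pose N := (\max_(i <- r) i).+1.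
apply: (@le_trans _ _ (\sum_(0 <= i < N) q ^+ i)).
  under eq_bigr do rewrite ger0_norm ?exprn_ge0//.
  rewrite [leRHS](bigID (mem r))/= -[leLHS]addr0 lerD ?sumr_ge0//; last first.
    by move=> i _; rewrite exprn_ge0.
  rewrite -[leRHS]big_filter (perm_big [seq x <- index_iota 0 N | x \in r])//.
  apply: uniq_perm => //; first by rewrite filter_uniq// iota_uniq.
  move=> y; rewrite mem_filter; case: (boolP (y \in r)) => //= yr.
  by rewrite mem_index_iota/= ltnS (big_rem y yr)/= leq_maxl.
rewrite -[leRHS]mul1r ler_pdivlMr// big_mkord.
have -> : (\sum_(i < N) q ^+ i) * (1 - q) = 1 - q ^+ N.
  by rewrite -[RHS]opprB subrX1 -mulNr opprB mulrC.
by rewrite lerBlDr lerDl exprn_ge0.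
Qed.

End has_sum_theory.

(** Converse of [has_sum_rows]: absolute summability yields some total, and summing by rows
    identifies it. *)
Lemma has_sum_of_rows {R : realType} {I J : choiceType} (f : I * J -> R)
    (g : I -> R) (s : R) :
  abs_summable f -> (forall i, has_sum (fun j => f (i, j)) (g i)) ->
  has_sum g s -> has_sum f s.
Proof.
move=> /abs_summable_has_sum[t ft] fg gs.
by rewrite (has_sum_unique gs (has_sum_rows ft fg)).
Qed.

Lemma has_sum_of_series_rows {R : realType} {J : choiceType} (f : nat * J -> R)
    (g : nat -> R) (s : R) :
  abs_summable f -> (forall i, has_sum (fun j => f (i, j)) (g i)) ->
  series g @ \oo --> s -> has_sum f s.
Proof.
move=> /abs_summable_has_sum[t ft] fg gs.
by rewrite (cvg_unique _ gs (has_sum_series (has_sum_rows ft fg))).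
Qed.

(** * Generating function of the integrals *)

Section Jint_gen.
Context {R : realType}.
Implicit Types a b c d y z : R.

Lemma has_sum_Jint a b c d y z : 0 <= a -> 0 < c -> 0 < d ->
  `|y| < c ^+ 2 -> `|z| < d ^+ 2 ->
  has_sum (fun p : nat * nat =>
    Jint a b c d p.1.+1 p.2.+1 * y ^+ p.1.+1 * z ^+ p.2.+1)
    (y * z * Jint a b (Num.sqrt (c ^+ 2 - y)) (Num.sqrt (d ^+ 2 - z)) 1 1).
Proof.
move=> a0 c0 d0 yc zd.
have dz : 0 < d ^+ 2 - z by rewrite subr_gt0; exact: le_lt_trans (ler_norm _) zd.
have c20 : 0 < c ^+ 2 by rewrite exprn_gt0.
have d20 : 0 < d ^+ 2 by rewrite exprn_gt0.
have geo (x e : R) : 0 < e -> `|x| < e -> 0 <= `|x| / e < 1.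
  by move=> e0 xe; rewrite divr_ge0 ?(ltW e0)// ltr_pdivrMr// mul1r.
have fs : abs_summable (fun p : nat * nat =>
    Jint a b c d p.1.+1 p.2.+1 * y ^+ p.1.+1 * z ^+ p.2.+1).
  apply: (@abs_summable_le _ _ _ (fun p => Jint a b c d 1 1 * y * z *
      (`|y| / c ^+ 2) ^+ p.1 * (`|z| / d ^+ 2) ^+ p.2)).
    move=> [m n] /=; have /andP[q1 _] := geo _ _ c20 yc.
    have /andP[q2 _] := geo _ _ d20 zd.
    rewrite [leLHS]normrM [X in X * _ <= _]normrM !normrX.
    rewrite [leRHS]normrM [X in _ <= X * _]normrM !normrX.
    rewrite (ger0_norm q1) (ger0_norm q2) !normrM !expr_div_n.
    rewrite !(ger0_norm (Jint_ge0 _ _ _ _ c0 d0)).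
    have h := Jint_le b m n a0 c0 d0.
    rewrite -!mulrA; apply: le_trans (ler_wpM2r _ h) _.
      by rewrite mulr_ge0 ?exprn_ge0.
    rewrite le_eqVlt; apply/orP; left; apply/eqP; rewrite !exprS; ring.
  have := abs_summable_prod (abs_summable_geometric (geo _ _ c20 yc))
     (abs_summable_geometric (geo _ _ d20 zd)).
  move=> [M HM]; exists (`|Jint a b c d 1 1 * y * z| * M) => r ur.
  apply: le_trans (ler_wpM2l (normr_ge0 _) (HM r ur)).
  rewrite mulr_sumr; apply: ler_sum => p _; by rewrite !normrM !mulrA.
(* Summing over n first turns d into [Num.sqrt (d ^+ 2 - z)] with exponent 1; the sum over m then
   does the same to c. *)
apply: (has_sum_of_series_rows (g := fun m =>
   z * (Jint a b c (Num.sqrt (d ^+ 2 - z)) m.+1 1 * y ^+ m.+1))) => //.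
  move=> m /=; apply: has_sum_of_series.
    exact: (abs_summable_row m fs).
  have := @cvg_series_Jint_d R a b c d _ z (ltn0Sn m) a0 c0 d0 zd.
  move=> /(cvgMl_tmp (a := y ^+ m.+1)).
  rewrite [X in _ --> X -> _](_ : _ =
    z * (Jint a b c (Num.sqrt (d ^+ 2 - z)) m.+1 1 * y ^+ m.+1)); last by ring.
  apply: cvg_trans; apply: near_eq_cvg; near=> N.
  by rewrite /series/= mulr_sumr; apply: eq_bigr => n _; ring.
have sdz : 0 < Num.sqrt (d ^+ 2 - z) by rewrite sqrtr_gt0.
have := @cvg_series_Jint_c R a b c _ _ y (ltn0Sn 0) a0 c0 sdz yc.
move=> /(cvgMl_tmp (a := z)); rewrite mulrA [z * y]mulrC.
apply: cvg_trans; apply: near_eq_cvg; near=> N.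
by rewrite /series/= mulr_sumr; apply: eq_bigr => n _; ring.
Unshelve. all: by end_near. Qed.
End Jint_gen.

(** * The numerator polynomials *)

Section numerator.
Context {R : realType}.
Implicit Types (p u v : {poly {poly R}}) (q c e : R) (m n k N : nat).

Local Notation "'Y" := ('X%:P : {poly {poly R}}).

(** The outer variable ['X] stands for c and the inner variable ['Y] for ad. Euler operators replace
    derivatives because d d/dd acts on functions of ad as (ad) d/d(ad), without a stray factor a. *)
Definition eulerX p : {poly {poly R}} := 'X * p^`().
Definition eulerY p : {poly {poly R}} := map_poly (fun r : {poly R} => 'X * r^`()) p.

Definition hpoly q : {poly {poly R}} := ('X + 'Y) ^+ 2 + q%:P%:P.

(* One differentiation step: with k = m-1, N = m+n-1, v = 'X and euler = eulerX
   it maps P_(m,n) to P_(m+1,n); with k = n-1, v = 'Y and euler = eulerY it maps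
   P_(m,n) to P_(m,n+1). *)
Definition num_step q k N v (euler : {poly {poly R}} -> {poly {poly R}}) p :=
  ((2 * k.+1)%:R^-1 : R)%:P%:P *
  ((2 * k).+1%:R * (hpoly q * p) + (2 * N)%:R * (v * ('X + 'Y)) * p
   - hpoly q * euler p).

Fixpoint numerX q m : {poly {poly R}} :=
  if m is m.+1 then num_step q m m.+1 'X eulerX (numerX q m) else 'X + 'Y.

(* numer q m n is P_(m+1,n+1), where 'X, 'Y and q stand for c, ad and (ab)^2. *)
Fixpoint numer q m n : {poly {poly R}} :=
  if n is n.+1 then num_step q n (m + n).+1 'Y eulerY (numer q m n) else numerX q m.

Definition ev p c e : R := p.[c%:P].[e].

Lemma ev_eulerX p c e : ev (eulerX p) c e = c * ev p^`() c e.
Proof. by rewrite /ev /eulerX !hornerE. Qed.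

Lemma ev_eulerY p c e : ev (eulerY p) c e = e * (p.[c%:P])^`().[e].
Proof.
rewrite /ev /eulerY.
have s : (size (map_poly (fun r : {poly R} => ('X * r^`())%R) p) <= size p)%N.
  exact: size_poly.
rewrite (horner_coef_wide _ s) (horner_coef p) !horner_sum linear_sum/= horner_sum.
rewrite mulr_sumr; apply: eq_bigr => i _.
rewrite coef_map_id0; last by rewrite linear0 mulr0.
by rewrite -polyC_exp derivM derivC mulr0 addr0 !hornerE.
Qed.

Lemma ev_num_step q k N v euler p c e :
  ev (num_step q k N v euler p) c e = (2 * k.+1%:R)^-1 *
   ((2 * k%:R + 1) * (((c + e) ^+ 2 + q) * ev p c e)
    + 2 * N%:R * (ev v c e * (c + e)) * ev p c e
    - ((c + e) ^+ 2 + q) * ev (euler p) c e).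
Proof.
rewrite /ev /num_step /hpoly !hornerE -!polyC_natr !hornerE /=.
by rewrite -[(2 * k).+1]addn1 natrD !natrM; ring.
Qed.

Lemma is_derive_ev_c p c e : is_derive c 1 (fun c => ev p c e) (ev p^`() c e).
Proof.
have E r x : ev r x e = (map_poly (horner_eval e) r).[x].
  by rewrite -[x in RHS](hornerC x e) -/(horner_eval e _) horner_map.
under eq_fun do rewrite E.
rewrite E -deriv_map; apply: DeriveDef; first exact: derivable_horner.
by rewrite -derive1E -derivE.
Qed.

Lemma is_derive_ev_e p c e :
  is_derive e 1 (fun e => ev p c e) ((p.[c%:P])^`().[e]).
Proof.
apply: DeriveDef; first exact: derivable_horner.
by rewrite -derive1E derivE.
Qed.

End numerator.
(** Differentiates [kappa * rho / (H ^+ N * t ^+ (2 * k).+1)], equates the result with the known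
    derivative of the integral and solves for [J2]. The constant [kappa] absorbs whatever does not
    depend on the variable, so that one statement serves c, d and the binomial series. *)
Lemma derive_quot_step {R : realType} (J rho H : R -> R)
    (T J2 rho' H' kappa : R) (N k : nat) : 0 < T -> 0 < H T ->
  (forall t, 0 < t -> J t = kappa * rho t / (H t ^+ N * t ^+ (2 * k).+1)) ->
  is_derive T 1 J (- (2 * k.+1%:R * T) * J2) ->
  is_derive T 1 rho rho' -> is_derive T 1 H H' ->
  J2 = kappa * ((2 * k.+1%:R)^-1 * ((2 * k%:R + 1) * (H T * rho T)
         + N%:R * (T * H') * rho T - H T * (T * rho')))
       / (H T ^+ N.+1 * T ^+ (2 * k.+1).+1).
Proof.
move=> T0 H0 JE dJ drho dH.
pose D t := H t ^+ N * t ^+ (2 * k).+1.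
have D0 : D T != 0 by rewrite mulf_neq0// expf_neq0 ?gt_eqF.
have dHN := is_derive1_expn N dH.
have dTk := is_derive1_expn (2 * k).+1 (is_derive_id T (1 : R)).
have dD : is_derive T 1 D (H T ^+ N * ((2 * k).+1%:R * T ^+ (2 * k) * 1)
     + T ^+ (2 * k).+1 * (N%:R * H T ^+ N.-1 * H')).
  exact: (is_deriveM dHN dTk).
have dV := @is_deriveV _ D T _ _ D0 dD.
have dJ' := is_deriveM (is_deriveZ kappa drho) dV.
have e : - (2 * k.+1%:R * T) * J2 = (kappa \*: rho) T *:
   (- D T ^- 2 *: (H T ^+ N * ((2 * k).+1%:R * T ^+ (2 * k) * 1)
     + T ^+ (2 * k).+1 * (N%:R * H T ^+ N.-1 * H'))) + (D T)^-1 *: (kappa *: rho').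
  have [_ <-] := dJ; have [_ <-] := dJ'.
  (* The closed form is known only for t > 0, hence only near [T]. *)
  apply: near_eq_derive.
  near=> t; rewrite JE//.
  by near: t; exact: lt_nbhsr.
have k0 : k.+1%:R != 0 :> R by rewrite pnatr_eq0.
have TN0 : T != 0 by rewrite gt_eqF.
have -> : J2 = - (- (2 * k.+1%:R * T) * J2) / (2 * k.+1%:R * T).
  by rewrite [- _ * J2]mulNr opprK mulrAC divff ?mul1r// !mulf_neq0// pnatr_eq0.
rewrite e /D /GRing.scale/= mulr1.
have -> : kappa *: rho T = kappa * rho T by [].
have -> : (2 * k.+1).+1 = (2 * k + 3)%N by rewrite mulnS; lia.
have NE : N%:R * H T ^+ N.-1 = N%:R * H T ^+ N / H T.
  case: N {D D0 dHN dD dV dJ' e JE} => [|N]; rewrite ?mul0r//= exprS.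
  by field; rewrite gt_eqF.
rewrite NE (exprS _ N) (exprS T (2 * k)) exprD -[(2 * k).+1]addn1 natrD natrM.
have HN0 : H T ^+ N != 0 by rewrite expf_neq0// gt_eqF.
have Tk0 : T ^+ (2 * k) != 0 by rewrite expf_neq0// gt_eqF.
move: (k.+1%:R : R) k0 => k1 k0.
have H00 : H T != 0 by rewrite gt_eqF.
by field; rewrite TN0 Tk0 HN0 H00 k0.
Unshelve. all: by end_near. Qed.

(** The induction follows the nesting of [numer]: m grows while n is minimal, then n grows. *)
Lemma Jint_numer {R : realType} (a b c d : R) m n : 0 <= a -> 0 < c -> 0 < d ->
  Jint a b c d m.+1 n.+1 = pi * ev (numer ((a * b) ^+ 2) m n) c (a * d) /
   (((c + a * d) ^+ 2 + (a * b) ^+ 2) ^+ (m + n).+1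
    * c ^+ (2 * m).+1 * d ^+ (2 * n).+1).
Proof.
move=> a0.
have H_gt0 (c' d' : R) : 0 < c' -> 0 < d' -> 0 < (c' + a * d') ^+ 2 + (a * b) ^+ 2.
  move=> c0 d0; rewrite ltr_wpDr ?sqr_ge0// exprn_gt0//.
  by rewrite ltr_wpDr// mulr_ge0// ltW.
have evXY c' e : ev ('X + 'X%:P : {poly {poly R}}) c' e = c' + e.
  by rewrite /ev !hornerE.
elim: n c d => [|n IHn] c d c0 d0.
  elim: m c c0 => [|m IHm] c c0.
    rewrite Jint11// evXY addn0 muln0 expr1 exprMn; field.
    by rewrite !gt_eqF// H_gt0.
  have dH : is_derive c 1 (fun t => (t + a * d) ^+ 2 + (a * b) ^+ 2) (2 * (c + a * d)).
    by apply: is_derive_eq; rewrite /GRing.scale/=; ring.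
  have JE t : 0 < t -> Jint a b t d m.+1 1 =
      (pi / d) * ev (numer ((a * b) ^+ 2) m 0) t (a * d) /
      (((t + a * d) ^+ 2 + (a * b) ^+ 2) ^+ m.+1 * t ^+ (2 * m).+1).
    move=> t0; rewrite IHm// addn0 muln0 expr1; field.
    by rewrite !expf_neq0 ?gt_eqF// H_gt0.
  have -> := derive_quot_step c0 (H_gt0 _ _ c0 d0) JE
    (is_derive_Jint_c _ (ltn0Sn m) (ltn0Sn 0) a0 c0 d0)
    (is_derive_ev_c _ c (a * d)) dH.
  rewrite /= ev_num_step ev_eulerX addn0 muln0 expr1.
  have -> : ev 'X c (a * d) = c by rewrite /ev !hornerE.
  by rewrite !invfM; ring.
have dH : is_derive d 1 (fun t => (c + a * t) ^+ 2 + (a * b) ^+ 2)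
    (2 * a * (c + a * d)).
  by apply: is_derive_eq; rewrite /GRing.scale/=; ring.
(* The chain rule yields a factor a, which joins the factor d of [derive_quot_step] to form the
   Euler operator in ad. *)
have drho : is_derive d 1 (fun t => ev (numer ((a * b) ^+ 2) m n) c (a * t))
    ((numer ((a * b) ^+ 2) m n).[c%:P]^`().[a * d] * a).
  apply: (@is_derive1_comp _ (ev (numer ((a * b) ^+ 2) m n) c) (fun t => a * t)).
    exact: is_derive_ev_e.
  by apply: is_derive_eq; rewrite /GRing.scale/=; ring.
have JE t : 0 < t -> Jint a b c t m.+1 n.+1 =
    (pi / c ^+ (2 * m).+1) * ev (numer ((a * b) ^+ 2) m n) c (a * t) /
    (((c + a * t) ^+ 2 + (a * b) ^+ 2) ^+ (m + n).+1 * t ^+ (2 * n).+1).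
  move=> t0; rewrite IHn//; field.
  by rewrite !expf_neq0 ?gt_eqF// H_gt0.
have -> := derive_quot_step d0 (H_gt0 _ _ c0 d0) JE
  (is_derive_Jint_d _ (ltn0Sn m) (ltn0Sn n) a0 c0 d0) drho dH.
rewrite /= ev_num_step ev_eulerY addnS.
have -> : ev 'X%:P c (a * d) = a * d by rewrite /ev !hornerE.
by rewrite !invfM; ring.
Qed.

(** * Weighted homogeneity of the numerators *)

Section homogeneity.
Context {R : realType}.
Implicit Types (p u v : {poly {poly R}}) (q : R) (P Q : R -> {poly {poly R}}).
Implicit Types (m n k N D i j : nat).
Local Notation "'Y" := ('X%:P : {poly {poly R}}).

(* Weighted homogeneity of degree D, where 'X and 'Y have weight 1 and q has
   weight 2. *)
Definition homog D P :=
  (forall q i j, (P q)`_i`_j = (P 1)`_i`_j * q ^+ (D - (i + j))./2) /\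
  (forall i j, ~~ ((i + j <= D)%N && (odd (i + j) == odd D)) -> (P 1)`_i`_j = 0).

Lemma homogD D P Q : homog D P -> homog D Q -> homog D (fun q => P q + Q q).
Proof.
move=> [P1 P2] [Q1 Q2]; split=> [q i j|i j h]; rewrite !coefD.
  by rewrite P1 Q1 mulrDl.
by rewrite P2// Q2// addr0.
Qed.

Lemma homogC D P (a : R) : homog D P -> homog D (fun q => a%:P%:P * P q).
Proof.
move=> [P1 P2]; split=> [q i j|i j h]; rewrite !coefCM.
  by rewrite P1 mulrA.
by rewrite P2// mulr0.
Qed.

Lemma homogX D P : homog D P -> homog D.+1 (fun q => 'X * P q).
Proof.
move=> [P1 P2]; split=> [q [|i] j|[|i] j h]; rewrite !coefXM ?coef0 ?mul0r//=.
by apply: P2; move: h; rewrite ?addSn ltnS/= eqb_negLR negbK.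
Qed.

Lemma homogY D P : homog D P -> homog D.+1 (fun q => 'Y * P q).
Proof.
move=> [P1 P2]; split=> [q i [|j]|i [|j] h]; rewrite !coefCM !coefXM ?mul0r//=.
  by rewrite P1 addnS subSS.
by apply: P2; move: h; rewrite addnS ltnS/= eqb_negLR negbK.
Qed.

Lemma homogq D P : homog D P -> homog D.+2 (fun q => q%:P%:P * P q).
Proof.
move=> [P1 P2]; split=> [q i j|i j h]; rewrite !coefCM ?mul1r.
  (* Beyond degree [D] the truncated subtraction would give the wrong power of q, but there the
     coefficient is zero. *)
  rewrite P1; have [ijD|ijD] := leqP (i + j) D; last first.
    by rewrite P2 ?(leqNgt _ D) ?ijD// !mul0r mulr0.
  by rewrite mulrCA -exprS -[D.+2]addn2 -addnBAC// addn2.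
apply: P2; move: h; rewrite /= negbK; apply: contra => /andP[h ->].
by rewrite (leq_trans h)// leqW.
Qed.

Lemma homog_eulerX D P : homog D P -> homog D (fun q => eulerX (P q)).
Proof.
move=> [P1 P2]; split=> [q [|i] j|[|i] j h]; rewrite /eulerX !coefXM ?coef0 ?mul0r//=;
  rewrite !coef_deriv !coefMn.
  by rewrite P1 mulrnAl.
by rewrite P2// mul0rn.
Qed.

Lemma coef_eulerY p i j : (eulerY p)`_i`_j = p`_i`_j *+ j.
Proof.
rewrite /eulerY coef_map_id0; last by rewrite linear0 mulr0.
by case: j => [|j]; rewrite coefXM ?mulr0n//= coef_deriv.
Qed.

Lemma coef_eulerX p i j : (eulerX p)`_i`_j = p`_i`_j *+ i.
Proof.
by case: i => [|i]; rewrite /eulerX coefXM ?coef0 ?mulr0n//= coef_deriv coefMn.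
Qed.

Lemma homog_eulerY D P : homog D P -> homog D (fun q => eulerY (P q)).
Proof.
move=> [P1 P2]; split=> [q i j|i j h]; rewrite !coef_eulerY.
  by rewrite P1 mulrnAl.
by rewrite P2// mul0rn.
Qed.

Lemma homog_hpoly D P : homog D P -> homog D.+2 (fun q => hpoly q * P q).
Proof.
move=> hP.
have -> : (fun q => hpoly q * P q) = fun q => 'X * ('X * P q) + 'X * ('Y * P q)
    + ('X * ('Y * P q) + 'Y * ('Y * P q)) + q%:P%:P * P q.
  by apply/funext => q; rewrite /hpoly; ring.
apply: homogD (homogq hP); apply: homogD; apply: homogD.
- exact: homogX (homogX hP).
- exact: homogX (homogY hP).
- exact: homogX (homogY hP).
- exact: homogY (homogY hP).
Qed.

Lemma homog_num_step D P k N v euler :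
  (forall D P, homog D P -> homog D.+1 (fun q => v * P q)) ->
  (forall D P, homog D P -> homog D (fun q => euler (P q))) ->
  homog D P -> homog D.+2 (fun q => num_step q k N v euler (P q)).
Proof.
move=> hv he hP; apply: homogC.
have -> : (fun q => (2 * k).+1%:R * (hpoly q * P q) +
    (2 * N)%:R * (v * ('X + 'Y)) * P q - hpoly q * euler (P q)) =
  fun q => ((2 * k).+1%:R%:P%:P * (hpoly q * P q)
    + (2 * N)%:R%:P%:P * (v * ('X * P q) + v * ('Y * P q)))
    + (-1)%:P%:P * (hpoly q * euler (P q)).
  by apply/funext => q; rewrite !polyC_natr !polyCN; ring.
apply: homogD; last by apply: homogC; apply: homog_hpoly; exact: he.
apply: homogD; first by apply: homogC; exact: homog_hpoly.
apply: homogC; apply: homogD; apply: hv; first exact: homogX.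
exact: homogY.
Qed.

Lemma homog_numer m n : homog (2 * (m + n)).+1 (fun q : R => numer q m n).
Proof.
elim: n => [|n IHn].
  rewrite addn0 /=; elim: m => [|m IHm].
    split=> [q i j|i j] /=; rewrite coefD coefX coefC.
    - by case: i j => [|[|i]] [|[|j]] /=; rewrite ?coefX ?coef1 ?coefD ?coef0
        ?coefX/= ?addr0 ?add0r ?mul0r ?mul1r ?coef1 ?mul1r ?mul0r.
    - by case: i j => [|[|i]] [|[|j]] /=; rewrite ?coefX ?coef1 ?coefD ?coef0
        ?coefX/= ?addr0 ?add0r ?coef1.
  rewrite mulnS; apply: homog_num_step IHm; [exact: homogX|exact: homog_eulerX].
rewrite addnS mulnS; apply: homog_num_step IHn; [exact: homogY|exact: homog_eulerY].
Qed.

End homogeneity.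

(** * The coefficients *)

Section coefficients.
Context {R : realType}.
Implicit Types (p u v : {poly {poly R}}) (m n k N L K i j r s : nat).
Local Notation "'Y" := ('X%:P : {poly {poly R}}).
Local Notation W := ('X + 'X%:P : {poly {poly R}}).

(** Membership in the ideal of polynomials without terms of total degree below [L]. Congruence
    modulo this ideal stands in for computing with formal power series. *)
Definition low_order L p := forall i j, (i + j < L)%N -> p`_i`_j = 0.

Lemma low_orderD L p u : low_order L p -> low_order L u -> low_order L (p + u).
Proof. by move=> hp hu i j ij; rewrite !coefD hp// hu// addr0. Qed.

Lemma low_orderM L p u : low_order L p -> low_order L (u * p).
Proof.
move=> hp i j ij; rewrite coefM coef_sum big1// => k _.
rewrite coefM big1// => l _; rewrite hp ?mulr0//.
by rewrite (leq_ltn_trans _ ij)// leq_add// leq_subr.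
Qed.

Lemma low_order_eulerX L p : low_order L p -> low_order L (eulerX p).
Proof. by move=> hp i j ij; rewrite coef_eulerX hp// mul0rn. Qed.

Lemma low_order_eulerY L p : low_order L p -> low_order L (eulerY p).
Proof. by move=> hp i j ij; rewrite coef_eulerY hp// mul0rn. Qed.

Lemma eulerXM p u : eulerX (p * u) = eulerX p * u + p * eulerX u.
Proof. by rewrite /eulerX derivM; ring. Qed.

Lemma eulerYM p u : eulerY (p * u) = eulerY p * u + p * eulerY u.
Proof.
have cE (v : {poly {poly R}}) i : (eulerY v)`_i = 'X * (v`_i)^`().
  by rewrite /eulerY coef_map_id0// linear0 mulr0.
apply/polyP => i; rewrite cE coefD !coefM linear_sum/= mulr_sumr -big_split/=.
by apply: eq_bigr => k _; rewrite !cE derivM; ring.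
Qed.

Lemma eulerXB p u : eulerX (p - u) = eulerX p - eulerX u.
Proof. by rewrite /eulerX derivB mulrBr. Qed.

Lemma eulerYB p u : eulerY (p - u) = eulerY p - eulerY u.
Proof.
by apply/polyP => i; apply/polyP => j; rewrite !(coefB, coef_eulerY) mulrnBl.
Qed.

(** [num_step] conjugated by a power of [hpoly 1]. On a monomial of degree a in the chosen variable
    it is multiplication by (2k+1-a) / (2(k+1)). *)
Definition Gstep k (euler : {poly {poly R}} -> {poly {poly R}}) p :=
  ((2 * k.+1)%:R^-1 : R)%:P%:P * ((2 * k).+1%:R * p - euler p).

(** By the Leibniz rule, differentiating [hpoly 1 ^+ N.+1] produces exactly the middle term of
    [num_step] with the opposite sign. *)
Lemma num_step_hpoly k N v euler p :
  (forall p u, euler (p * u) = euler p * u + p * euler u) ->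
  euler (hpoly 1) = 2%:R * (W * v) ->
  num_step 1 k N.+1 v euler (hpoly 1 ^+ N.+1 * p) =
  hpoly 1 ^+ N.+2 * Gstep k euler p.
Proof.
move=> eM eh.
have e1 : euler 1 = 0.
  have := eM 1 1; rewrite !mul1r mulr1 -[LHS]addr0 => /addrI/esym//.
have eX M : euler (hpoly 1 ^+ M.+1) = M.+1%:R * (hpoly 1 ^+ M * (2%:R * (W * v))).
  elim: M => [|M IH]; first by rewrite !expr1 eh expr0 !mul1r.
  rewrite exprS eM IH eh -[M.+2]addn1 natrD [hpoly 1 ^+ M.+1 in RHS]exprS exprS.
  ring.
rewrite /num_step /Gstep eM eX natrM !exprS; ring.
Qed.

Lemma eulerX_hpoly : eulerX (hpoly 1 : {poly {poly R}}) = 2%:R * (W * 'X).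
Proof. by rewrite /eulerX /hpoly !poly.derivE; ring. Qed.

Lemma eulerY_hpoly : eulerY (hpoly 1 : {poly {poly R}}) = 2%:R * (W * 'Y).
Proof.
have eC (a : {poly R}) : eulerY a%:P = ('X * a^`())%:P.
  apply/polyP => i; rewrite /eulerY coef_map_id0 ?linear0 ?mulr0// !coefC.
  by case: eqP => // _; rewrite linear0 mulr0.
have eX : eulerY ('X : {poly {poly R}}) = 0.
  apply/polyP => i; apply/polyP => j; rewrite coef_eulerY coefX !coef0.
  by case: eqP => _; case: j => [|j]; rewrite ?mulr0n// ?coef1 ?coef0 ?mul0rn.
have -> : hpoly (1 : R) = 'X * 'X - (- ('X * 'Y + 'X * 'Y)) - (- ('Y * 'Y)) - (- 1%:P).
  by rewrite /hpoly; ring.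
have eN p : eulerY (- p) = - eulerY p.
  rewrite -[- p]sub0r eulerYB -[0 : {poly {poly R}}]polyC0 eC linear0.
  by rewrite mulr0 polyC0 sub0r.
have eD p u : eulerY (p + u) = eulerY p + eulerY u.
  by rewrite -[u in LHS]opprK eulerYB eN opprK.
rewrite !eulerYB !eN eD !eulerYM eX !eC derivX poly.derivE mulr1.
ring.
Qed.

(* trunc K m n approximates the power series numer 1 m n / (hpoly 1)^(m+n+1)
   modulo total degree 2K+1. *)
Fixpoint truncX K m : {poly {poly R}} :=
  if m is m.+1 then Gstep m eulerX (truncX K m)
  else \sum_(k < K) (-1) ^+ k * W ^+ (2 * k).+1.

Fixpoint trunc K m n : {poly {poly R}} :=
  if n is n.+1 then Gstep n eulerY (trunc K m n) else truncX K m.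

Lemma coef_expXY n i j : (W ^+ n)`_i`_j = if (i + j == n)%N then 'C(n, j)%:R else 0.
Proof.
elim: n i j => [|n IHn] i j.
  rewrite expr0 coef1; case: i => [|i]; last by rewrite coef0.
  by rewrite coef1 add0n; case: j => [|j].
rewrite exprS mulrDl !coefD coefXM coefCM coefXM.
case: i j => [|i] [|j] /=; rewrite ?coef0 ?IHn ?add0r ?addr0//.
- by rewrite add0n eqSS; case: eqP => // ->; rewrite !binn.
- by rewrite !addn0 eqSS !bin0.
- have -> : (i.+1 + j.+1 == n.+1)%N = ((i + j).+1 == n)%N.
    by rewrite addSn addnS eqSS.
  rewrite [(i + j.+1)%N]addnS [(i.+1 + j)%N]addSn.
  by case: eqP => _; rewrite ?addr0// binS natrD.
Qed.

(* Coefficient of y^m in (1 - y)^((r-1)/2). *)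
Definition beta m r : R := (-1) ^+ m * gbinom ((r%:R - 1) / 2) m.

Lemma beta0 r : beta 0 r = 1.
Proof. by rewrite /beta /gbinom big_ord0 fact0 divr1 mulr1. Qed.

(** The factor is the eigenvalue of [Gstep] on degree r; this is how binomial coefficients of
    half-integers enter. *)
Lemma betaS m r :
  beta m.+1 r = (2 * m.+1)%:R^-1 * ((2 * m).+1%:R - r%:R) * beta m r.
Proof.
rewrite /beta /gbinom big_ord_recr/= factS natrM exprS.
have h1 : (m`!)%:R != 0 :> R by rewrite pnatr_eq0 -lt0n fact_gt0.
have h2 : m.+1%:R != 0 :> R by rewrite pnatr_eq0.
rewrite natrM -[(2 * m).+1]addn1 natrD natrM.
move: (m.+1%:R : R) h2 => k h2; field.
by rewrite h1 h2.
Qed.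

(* Coefficient of v^r w^s in numer 1 m n / (hpoly 1)^(m+n+1). *)
Definition gcoef m n r s : R := if odd (r + s) then
  (-1) ^+ (r + s)./2 * 'C(r + s, s)%:R * beta m r * beta n s else 0.

Lemma coef_Gstep k (euler : {poly {poly R}} -> {poly {poly R}}) p i j (a : nat) :
  (euler p)`_i`_j = p`_i`_j *+ a ->
  (Gstep k euler p)`_i`_j = (2 * k.+1)%:R^-1 * ((2 * k).+1%:R - a%:R) * p`_i`_j.
Proof.
move=> e; rewrite /Gstep !coefCM !coefB mulr_natl !coefMn e.
by rewrite -mulrA mulrBl !mulr_natl.
Qed.

Lemma coef_trunc K m n r s : (r + s < (2 * K).+1)%N ->
  (trunc K m n)`_r`_s = gcoef m n r s.
Proof.
move=> rsK.
(* Every step is diagonal, so only the truncated geometric series at m = n = 0 remains; in it the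
   single term k = [(r + s)./2] contributes. *)
suff -> : (trunc K m n)`_r`_s = beta m r * beta n s * (trunc K 0 0)`_r`_s.
  rewrite /= coef_sum coef_sum /gcoef.
  have E (k : nat) : ((-1) ^+ k * W ^+ (2 * k).+1)`_r`_s =
      (-1) ^+ k * (if (r + s == (2 * k).+1)%N then 'C((2 * k).+1, s)%:R else 0).
    have -> : (-1) ^+ k = ((-1) ^+ k : R)%:P%:P :> {poly {poly R}}.
      by rewrite !polyC_exp !polyCN.
    by rewrite !coefCM coef_expXY.
  under eq_bigr do rewrite E.
  case: ifPn => [od|ev_]; last first.
    rewrite big1 ?mulr0// => k _; case: eqP => [h|]; last by rewrite mulr0.
    by move: ev_; rewrite h /= mul2n odd_double.
  have h : (r + s = (2 * (r + s)./2).+1)%N.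
    by rewrite -[LHS]odd_double_half od mul2n.
  have hk : ((r + s)./2 < K)%N by move: rsK; rewrite h; lia.
  rewrite (bigD1 (Ordinal hk))//= -h eqxx big1 ?addr0; last first.
    move=> k /eqP kh; case: eqP => [h'|]; last by rewrite mulr0.
    by case: kh; apply: val_inj => /=; lia.
  ring.
elim: n => [|n IHn] /=.
  rewrite beta0 mulr1; elim: m => [|m IHm] /=; first by rewrite beta0 mul1r.
  by rewrite (coef_Gstep _ (coef_eulerX _ _ _)) IHm betaS !mulrA.
rewrite (coef_Gstep _ (coef_eulerY _ _ _)) IHn betaS; ring.
Qed.

Lemma low_order_num_step L k N v euler p u :
  (forall p u, euler (p - u) = euler p - euler u) ->
  (forall p, low_order L p -> low_order L (euler p)) ->
  low_order L (p - u) ->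
  low_order L (num_step 1 k N v euler p - num_step 1 k N v euler u).
Proof.
move=> eB eL h.
have -> : num_step 1 k N v euler p - num_step 1 k N v euler u =
    num_step 1 k N v euler (p - u).
  by rewrite /num_step eB; ring.
apply: low_orderM.
have -> : (2 * k).+1%:R * (hpoly 1 * (p - u)) + (2 * N)%:R * (v * W) * (p - u) -
    hpoly 1 * euler (p - u) = ((2 * k).+1%:R * hpoly 1 + (2 * N)%:R * (v * W)) * (p - u)
    + (- hpoly 1) * euler (p - u).
  by ring.
by apply: low_orderD; apply: low_orderM => //; exact: eL.
Qed.

(** At the base this is the exact remainder of a geometric series, because [hpoly 1] is W^2 + 1. The
    order is kept at each step since Euler operators, unlike derivatives, do not lower degrees. *)
Lemma low_order_numer K m n :
  low_order (2 * K).+1 (numer 1 m n - hpoly 1 ^+ (m + n).+1 * trunc K m n).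
Proof.
elim: n => [|n IHn].
  rewrite addn0 /=; elim: m => [|m IHm] /=.
    have -> : W - hpoly 1 ^+ 1 * \sum_(k < K) (-1) ^+ k * W ^+ (2 * k).+1 =
        (-1) ^+ K * W ^+ (2 * K).+1.
      elim: K => [|K IH]; first by rewrite big_ord0 mulr0 subr0 expr0 mul1r.
      rewrite big_ord_recr/= mulrDr opprD addrA IH.
      by rewrite mulnS !exprS /hpoly; ring.
    by apply: low_orderM => i j ij; rewrite coef_expXY ltn_eqF.
  rewrite -(@num_step_hpoly m m 'X eulerX (truncX K m) eulerXM eulerX_hpoly).
  apply: low_order_num_step IHm; [exact: eulerXB|exact: low_order_eulerX].
rewrite addnS /=.
rewrite -(@num_step_hpoly n (m + n) 'Y eulerY (trunc K m n) eulerYM eulerY_hpoly).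
apply: low_order_num_step IHn; [exact: eulerYB|exact: low_order_eulerY].
Qed.

(* Coefficient of v^i w^j in ((v + w)^2 + 1)^N. *)
Definition hcoef N i j : R :=
  if odd (i + j) then 0 else 'C(N, (i + j)./2)%:R * 'C(i + j, j)%:R.

Lemma coef_hpoly_exp N i j : (hpoly 1 ^+ N)`_i`_j = hcoef N i j.
Proof.
rewrite /hpoly exprDn !coef_sum /hcoef.
have E (k : 'I_N.+1) : ((W ^+ 2) ^+ (N - k) * 1%:P%:P ^+ k *+ 'C(N, k))`_i`_j =
   (if (i + j == 2 * (N - k))%N then 'C(2 * (N - k), j)%:R else 0) *+ 'C(N, k).
  by rewrite -exprM expr1n mulr1 !coefMn coef_expXY.
under eq_bigr do rewrite E.
case: ifPn => [od|ev_].
  rewrite big1// => k _; case: eqP => [h|]; last by rewrite mul0rn.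
  by move: od; rewrite h mul2n odd_double.
have h : (i + j = 2 * (i + j)./2)%N.
  by rewrite -[LHS]odd_double_half (negbTE ev_) mul2n.
have [lN|Nl] := leqP (i + j)./2 N; last first.
  rewrite bin_small// mul0r big1// => k _; case: eqP => [h'|]; last by rewrite mul0rn.
  by exfalso; have := ltn_ord k; lia.
have hk : (N - (i + j)./2 < N.+1)%N by rewrite ltnS leq_subr.
rewrite (bigD1 (Ordinal hk))//= big1 ?addr0; last first.
  move=> k /eqP kh; case: eqP => [h'|]; last by rewrite mul0rn.
  by case: kh; apply: val_inj => /=; have := ltn_ord k; lia.
by rewrite subKn// -h eqxx bin_sub// -mulr_natl.
Qed.

(** The truncation at K = i + j is exact up to degree 2(i + j), which covers the coefficient at (i,
    j); what is left is the Cauchy product with a power of [hpoly 1]. *)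
Lemma coef_numer m n i j : (numer 1 m n)`_i`_j =
  \sum_(r < i.+1) \sum_(s < j.+1)
    gcoef m n r s * hcoef (m + n).+1 (i - r) (j - s).
Proof.
have := @low_order_numer (i + j) m n i j; rewrite !coefB => /(_ _)/wrap[].
  by rewrite ltnS leq_pmull.
move=> /subr0_eq ->; rewrite mulrC coefM coef_sum; apply: eq_bigr => r _.
rewrite coefM; apply: eq_bigr => s _.
rewrite coef_hpoly_exp coef_trunc// ltnS.
have := ltn_ord r; have := ltn_ord s; rewrite !ltnS; lia.
Qed.

End coefficients.

(** * The generating function of the coefficients *)

Section binomial_series.
Context {R : realType}.
Implicit Types (x y z : R) (m n r s : nat).

Lemma gbinomS (alpha : R) m :
  gbinom (alpha + 1) m.+1 = gbinom alpha m.+1 + gbinom alpha m.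
Proof.
rewrite /gbinom big_ord_recl/= subr0.
under eq_bigr => i _ do rewrite /bump leq0n natrD opprD addrA addrK.
rewrite big_ord_recr/= factS natrM.
have h1 : (m`!)%:R != 0 :> R by rewrite pnatr_eq0 -lt0n fact_gt0.
have h2 : m.+1%:R != 0 :> R by rewrite pnatr_eq0.
move: h2; rewrite -natr1 => h2; field.
by rewrite h1 h2.
Qed.

(** Coefficient form of (1 - y)^((r+1)/2) = (1 - y) (1 - y)^((r-1)/2). *)
Lemma betaSS m r : beta m.+1 r.+2 = beta m.+1 r - beta m r :> R.
Proof.
rewrite /beta (_ : (r.+2%:R - 1) / 2 = (r%:R - 1) / 2 + 1); last first.
  by rewrite -addn2 natrD; field.
by rewrite gbinomS exprS; ring.
Qed.

Lemma bin_le_exp2 n k : ('C(n, k) <= 2 ^ n)%N.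
Proof.
elim: n k => [|n IH] [|k]; rewrite ?bin0 ?expn_gt0//.
by rewrite binS expnS mul2n -addnn leq_add.
Qed.

(** Compares the recursion [betaS] with that of 'C(r + m, m): |2m + 1 - r| is at most 2(r + m +
    1). *)
Lemma beta_le m r : `|beta m r| <= 2 ^+ (r + m) :> R.
Proof.
apply: (@le_trans _ _ 'C(r + m, m)%:R); last by rewrite -natrX ler_nat bin_le_exp2.
elim: m => [|m IH]; first by rewrite beta0 normr1 bin0.
rewrite betaS normrM [X in X * _]normrM normfV normr_nat.
have h : 0 < (2 * m.+1)%:R :> R by rewrite ltr0n.
rewrite -mulrA mulrC ler_pdivrMr//.
have -> : 'C(r + m.+1, m.+1)%:R * (2 * m.+1)%:R =
    (2 * (r + m.+1))%:R * 'C(r + m, m)%:R :> R.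
  by rewrite -!natrM; congr (_%:R); rewrite addnS -mulnA mul_bin_diag; lia.
apply: ler_pM => //; apply: (le_trans (ler_normB _ _)).
by rewrite !normr_nat -natrD ler_nat; lia.
Qed.

(* The case a = 0 gives the binomial series of (1 - z)^(-1/2) through the
   generating function of the integrals. *)
Lemma Jint_beta n (t : R) : 0 < t ->
  Jint 0 0 1 t 1 n.+1 = pi * beta n 0 / t ^+ (2 * n).+1.
Proof.
elim: n t => [|n IH] t t0.
  by rewrite Jint11// beta0 !mul0r addr0 muln0 expr1; field; rewrite gt_eqF.
have JE x : 0 < x -> Jint 0 0 1 x 1 n.+1 =
    pi * beta n 0 * 1 / (1 ^+ 0 * x ^+ (2 * n).+1).
  by move=> x0; rewrite IH// mul1r mulr1.
have d1 : is_derive t 1 (fun=> 1 : R) 0 by exact: is_derive_cst.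
have -> := @derive_quot_step R _ (fun=> 1) (fun=> 1) t _ 0 0 (pi * beta n 0) 0 n
  t0 ltr01 JE
  (is_derive_Jint_d _ (ltn0Sn 0) (ltn0Sn n) (lexx 0) ltr01 t0)
  d1 d1.
rewrite betaS natrM -[(2 * n).+1 in RHS]addn1 natrD natrM !expr1n.
have n0 : n.+1%:R != 0 :> R by rewrite pnatr_eq0.
have tn : t ^+ (2 * n.+1).+1 != 0 by rewrite expf_neq0// gt_eqF.
move: (n.+1%:R : R) n0 => k n0.
by field; rewrite n0 tn.
Qed.

Lemma cvg_series_beta0 z : `|z| < 1 ->
  series (fun n => beta n 0 * z ^+ n) @ \oo --> (Num.sqrt (1 - z))^-1.
Proof.
(* The series of integrals carries a factor z pi, which has to be divided out. *)
move=> z1; have [->|z0] := eqVneq z 0.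
  rewrite subr0 sqrtr1 invr1; apply: cvg_near_cst; near=> N.
  rewrite /series/= big_ltn; last by near: N; exact: nbhs_infty_gt.
  rewrite beta0 expr0 mulr1 big_nat big1 ?addr0// => i /andP[i0 _].
  by rewrite expr0n gtn_eqF// mulr0.
have sz : 0 < Num.sqrt (1 - z).
  by rewrite sqrtr_gt0 subr_gt0 (le_lt_trans (ler_norm _)).
have z1' : `|z| < 1 ^+ 2 by rewrite expr1n.
have := @cvg_series_Jint_d R 0 0 1 1 1 z (ltn0Sn 0) (lexx 0) ltr01 ltr01 z1'.
rewrite expr1n Jint11// => /(cvgMl_tmp (a := (z * pi)^-1)).
have p0 : pi != 0 :> R by rewrite gt_eqF// pi_gt0.
rewrite [X in _ --> X -> _](_ : _ = (Num.sqrt (1 - z))^-1); last first.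
  rewrite !mul0r expr0n/= mul0r !addr0 expr1n !mul1r !mulr1.
  by move: (pi : R) p0 => P p0; field; rewrite z0 p0 gt_eqF.
apply: cvg_trans; apply: near_eq_cvg; near=> N.
rewrite /series/= mulr_sumr; apply: eq_bigr => n _.
by rewrite Jint_beta// expr1n exprS; move: (pi : R) p0 => P p0; field; rewrite z0 p0.
Unshelve. all: by end_near. Qed.

(** Induction on r in steps of two, each multiplying the sum by 1 - z; for r = 1 the series reduces
    to its constant term. *)
Lemma cvg_series_beta r z : `|z| < 1 ->
  series (fun n => beta n r * z ^+ n) @ \oo -->
    Num.sqrt (1 - z) ^+ r / Num.sqrt (1 - z).
Proof.
move=> z1; have z1' : 0 < 1 - z.
  by rewrite subr_gt0 (le_lt_trans (ler_norm _)).
have sz : Num.sqrt (1 - z) != 0 by rewrite gt_eqF// sqrtr_gt0.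
have [k ->] : exists k, r = (k.*2 + odd r)%N.
  by exists r./2; rewrite addnC odd_double_half.
elim: k => [|k IH].
  rewrite double0 add0n; case: (odd r) => /=.
    rewrite expr1 divff//; apply: cvg_near_cst; near=> N.
    rewrite /series/= big_ltn; last by near: N; exact: nbhs_infty_gt.
    rewrite beta0 expr0 mulr1 big_nat big1 ?addr0// => -[//|i] _.
    by rewrite /beta /gbinom subrr mul0r big_ord_recl/= subrr !mul0r mulr0 mul0r.
  by rewrite mul1r; exact: cvg_series_beta0.
rewrite doubleS !addSn.
have -> : Num.sqrt (1 - z) ^+ (k.*2 + odd r).+2 / Num.sqrt (1 - z) =
    (Num.sqrt (1 - z) ^+ (k.*2 + odd r) / Num.sqrt (1 - z)) -
    z * (Num.sqrt (1 - z) ^+ (k.*2 + odd r) / Num.sqrt (1 - z)).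
  rewrite -[(_ + _).+2]addn2 exprD sqr_sqrtr ?ltW//; field.
  by rewrite sz.
set L := Num.sqrt (1 - z) ^+ _ / _ in IH *.
have IHS : series (fun n => beta n (k.*2 + odd r) * z ^+ n) N.+1 @[N --> \oo] --> L.
  by rewrite (cvg_shiftS (series _)).
suff : series (fun n => beta n (k.*2 + odd r).+2 * z ^+ n) N.+1 @[N --> \oo]
    --> L - z * L by rewrite (cvg_shiftS (series _)).
have -> : (fun N => series (fun n => beta n (k.*2 + odd r).+2 * z ^+ n) N.+1) =
    fun N => series (fun n => beta n (k.*2 + odd r) * z ^+ n) N.+1 -
             z * series (fun n => beta n (k.*2 + odd r) * z ^+ n) N.
  apply/funext => N.
  rewrite /series/= !big_nat_recl//= !beta0 mulr_sumr -addrA -sumrB; congr (_ + _).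
  by apply: eq_bigr => i _; rewrite betaSS exprS; ring.
exact: cvgB IHS (cvgMl_tmp IH).
Unshelve. all: by end_near. Qed.

Lemma abs_summable_half : abs_summable (fun n => (1 / 2 : R) ^+ n).
Proof. by apply: abs_summable_geometric; lra. Qed.

(** With |x| at most 1/4 the bound 2^(r+n) on the coefficients leaves a geometric series of ratio
    1/2. *)
Lemma has_sum_beta r x : `|x| <= 1 / 4 ->
  abs_summable (fun n => beta n r * x ^+ n) /\
  has_sum (fun n => beta n r * x ^+ n) (Num.sqrt (1 - x) ^+ r / Num.sqrt (1 - x)).
Proof.
move=> x4; have abs : abs_summable (fun n => beta n r * x ^+ n).
  have [M HM] := abs_summable_half.
  exists (2 ^+ r * M) => s us; apply: le_trans (ler_wpM2l _ (HM s us)) => //.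
  rewrite mulr_sumr; apply: ler_sum => n _.
  rewrite normrM !normrX; apply: (@le_trans _ _ (2 ^+ (r + n) * (1 / 4) ^+ n)).
    apply: ler_pM => //; first exact: beta_le.
    by rewrite lerXn2r ?nnegrE//; lra.
  rewrite ger0_norm ?exprD -?mulrA -?exprMn; last by lra.
  by rewrite ler_wpM2l ?exprn_ge0// lerXn2r ?nnegrE//; lra.
split=> //; apply: has_sum_of_series abs _; apply: cvg_series_beta; lra.
Qed.

End binomial_series.

Section coef_generating.
Context {R : realType}.
Implicit Types (x y z v w : R) (m n r s i j k : nat).

Lemma abs_summable_half2 :
  abs_summable (fun p : nat * nat => (1 / 2 : R) ^+ (p.1 + p.2)).
Proof.
have := abs_summable_prod (@abs_summable_half R) (@abs_summable_half R).
by apply: abs_summable_le => p; rewrite exprD.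
Qed.

Lemma has_sum_single {T : choiceType} (f : T -> R) t0 :
  (forall t, t != t0 -> f t = 0) -> has_sum f (f t0).
Proof.
move=> f0; have := @has_sum_finsupp R T f [:: t0] isT.
by rewrite big_seq1; apply => t; rewrite inE => /f0.
Qed.

Lemma has_sum0 {T : choiceType} (f : T -> R) :
  (forall t, f t = 0) -> has_sum f 0.
Proof.
move=> f0; have := @has_sum_finsupp R T f [::] isT.
by rewrite big_nil; apply => t _; exact: f0.
Qed.

Lemma has_sum_geometric (q a : R) :
  `|q| < 1 -> has_sum (fun k => a * q ^+ k) (a / (1 - q)).
Proof.
move=> q1; apply: has_sum_of_series; last exact: cvg_geometric_series.
have [M HM] := @abs_summable_geometric R `|q| (introT andP (conj (normr_ge0 q) q1)).
exists (`|a| * M) => s us; apply: le_trans (ler_wpM2l _ (HM s us)) => //.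
by rewrite mulr_sumr; apply: ler_sum => n _; rewrite normrM !normrX normr_id.
Qed.

(** The geometric series in -(x + y)^2 is expanded binomially. Summing the resulting family by k
    gives the fraction, by (r, s) the stated terms. *)
Lemma has_sum_odd_powers x y : `|x| <= 1 / 8 -> `|y| <= 1 / 8 ->
  has_sum (fun p : nat * nat => if odd (p.1 + p.2) then
      (-1) ^+ (p.1 + p.2)./2 * 'C(p.1 + p.2, p.2)%:R * x ^+ p.1 * y ^+ p.2 else 0)
    ((x + y) / ((x + y) ^+ 2 + 1)).
Proof.
move=> x8 y8.
pose g (p : nat * nat) : R :=
  (-1) ^+ (p.1 + p.2)./2 * 'C(p.1 + p.2, p.2)%:R * x ^+ p.1 * y ^+ p.2.
(* Supported on r + s = 2k + 1, where a term is at most 4^-(r+s), hence at most (1/2)^k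
   (1/2)^(r+s). *)
pose F (t : nat * (nat * nat)) : R :=
  if (t.2.1 + t.2.2 == t.1.*2.+1)%N then g t.2 else 0.
have Fs : abs_summable F.
  have := abs_summable_prod (@abs_summable_half R) abs_summable_half2.
  apply: abs_summable_le => -[k [r s]] /=; rewrite /F /=.
  case: eqP => [h|_]; last by rewrite normr0.
  rewrite /g /= 3!normrM normrX normrN1 expr1n !mul1r normr_nat !normrX.
  rewrite [leRHS]ger0_norm; last by rewrite mulr_ge0// exprn_ge0; lra.
  apply: (@le_trans _ _ (2 ^+ (r + s) * (1 / 8) ^+ r * (1 / 8) ^+ s)).
    apply: ler_pM; rewrite ?mulr_ge0 ?exprn_ge0//; last first.
      by rewrite lerXn2r ?nnegrE//; lra.
    apply: ler_pM; rewrite ?mulr_ge0 ?exprn_ge0//; last first.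
      by rewrite lerXn2r ?nnegrE//; lra.
    by rewrite -natrX ler_nat bin_le_exp2.
  rewrite -mulrA -exprD -exprMn -[leRHS]exprD.
  have -> : 2 * (1 / 8) = 2^-1 ^+ 2 :> R by field.
  rewrite -exprM ler_wiXn2l//; try lra.
  by rewrite h -addnn; lia.
have row1 k : has_sum (fun p => F (k, p)) ((x + y) * (- (x + y) ^+ 2) ^+ k).
  have -> : (x + y) * (- (x + y) ^+ 2) ^+ k =
      \sum_(p <- [seq (k.*2.+1 - s, s)%N | s <- iota 0 k.*2.+2]) F (k, p).
    rewrite big_map -/(index_iota 0 k.*2.+2) big_mkord.
    rewrite -mulN1r exprMn -exprM mulrCA -exprS mul2n exprDn mulr_sumr.
    apply: eq_bigr => s _; have sk := ltn_ord s.
    have e : (k.*2.+1 - s + s)%N = k.*2.+1 by rewrite subnK.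
    have hf : (k.*2.+1)./2 = k by rewrite /= uphalf_double.
    by rewrite /F /g /= e eqxx hf -mulr_natr; ring.
  apply: has_sum_finsupp.
    by rewrite map_inj_uniq ?iota_uniq// => s s' [].
  move=> [r s] rs; rewrite /F /=; case: eqP => // h; case/negP: rs.
  apply/mapP; exists s; first by rewrite mem_iota/= -h; lia.
  by rewrite -h addnK.
have row2 p : has_sum (fun k => F (k, p)) (if odd (p.1 + p.2) then g p else 0).
  case: ifPn => h.
    have <- : F ((p.1 + p.2)./2, p) = g p.
      by rewrite /F /= -[X in X == _]odd_double_half h eqxx.
    apply: (has_sum_single (f := fun k => F (k, p))) => k kh.
    rewrite /F /=; case: eqP => // e.
    by move: kh; rewrite e /= uphalf_double eqxx.
  apply: has_sum0 => k; rewrite /F /=; case: eqP => // e.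
  by move: h; rewrite e /= odd_double.
have [S FS] := abs_summable_has_sum Fs.
have S1 := has_sum_rows FS row1.
have geo : has_sum (fun k => (x + y) * (- (x + y) ^+ 2) ^+ k)
    ((x + y) / ((x + y) ^+ 2 + 1)).
  rewrite [_ ^+ 2 + 1]addrC -[(x + y) ^+ 2 in X in _ / X]opprK.
  apply: has_sum_geometric; rewrite normrN normrX -[ltRHS](expr1n _ 2).
  rewrite ltrXn2r// ?nnegrE//.
  by apply: le_lt_trans (ler_normD _ _) _; lra.
rewrite (has_sum_unique geo S1).
pose sw (t : (nat * nat) * nat) := (t.2, t.1).
pose sw' (t : nat * (nat * nat)) := (t.2, t.1).
have swK : cancel sw sw' by move=> [].
have swK' : cancel sw' sw by move=> [].
have FS' := has_sum_bij swK swK' FS.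
exact: (has_sum_rows FS' row2).
Qed.

Lemma hcoef_le N i j : `|hcoef N i j| <= 2 ^+ (N + (i + j)) :> R.
Proof.
rewrite /hcoef; case: ifP => _; first by rewrite normr0 exprn_ge0.
rewrite normrM !normr_nat exprD; apply: ler_pM => //.
  by rewrite -natrX ler_nat bin_le_exp2.
by rewrite -natrX ler_nat bin_le_exp2.
Qed.

Lemma gcoef_le m n r s : `|gcoef m n r s| <= 2 ^+ (2 * (r + s) + (m + n)) :> R.
Proof.
rewrite /gcoef; case: ifP => _; last by rewrite normr0 exprn_ge0.
rewrite 3!normrM normrX normrN1 expr1n mul1r normr_nat.
have -> : (2 * (r + s) + (m + n) = (r + s) + (r + m) + (s + n))%N by lia.
rewrite 2!exprD; apply: ler_pM; rewrite ?mulr_ge0//; last exact: beta_le.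
apply: ler_pM => //; last exact: beta_le.
by rewrite -natrX ler_nat bin_le_exp2.
Qed.

Lemma has_sum_mul {I J : choiceType} (f : I -> R) (g : J -> R) (a b : R) :
  abs_summable f -> abs_summable g -> has_sum f a -> has_sum g b ->
  has_sum (fun p => f p.1 * g p.2) (a * b).
Proof.
move=> fs gs fa gb; apply: (has_sum_of_rows (g := fun k : I => f k * b)).
- exact: abs_summable_prod.
- by move=> k; exact: has_sumZ.
- by rewrite mulrC; under eq_fun do rewrite mulrC; exact: has_sumZ.
Qed.

Lemma ev_wide (p : {poly {poly R}}) K (c e : R) :
  (forall i j, (K <= i)%N || (K <= j)%N -> p`_i`_j = 0) ->
  ev p c e = \sum_(i < K) \sum_(j < K) p`_i`_j * c ^+ i * e ^+ j.
Proof.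
move=> pK; have sp : (size p <= K)%N.
  by apply/leq_sizeP => i Ki; apply/polyP => j; rewrite coef0 pK// Ki.
have spi i : (size (p`_i)%R <= K)%N.
  by apply/leq_sizeP => j Kj; rewrite pK// Kj orbT.
rewrite /ev (horner_coef_wide _ sp) horner_sum; apply: eq_bigr => i _.
rewrite -polyC_exp !hornerE (horner_coef_wide _ (spi i)) mulr_suml.
by apply: eq_bigr => j _; rewrite mulrAC.
Qed.

Lemma has_sum_hcoef N v w r s :
  has_sum (fun p : nat * nat => if (r <= p.1)%N && (s <= p.2)%N then
      hcoef N (p.1 - r) (p.2 - s) * v ^+ p.1 * w ^+ p.2 else 0)
    (v ^+ r * w ^+ s * ((v + w) ^+ 2 + 1) ^+ N).
Proof.
have h0 i j : (N.*2 < i + j)%N -> hcoef N i j = 0 :> R.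
  move=> ij; rewrite /hcoef; case: ifP => // ev_.
  by rewrite bin_small ?mul0r// -ltn_double (leq_trans ij)// -[leqLHS]odd_double_half ev_.
have hE : ((v + w) ^+ 2 + 1) ^+ N = \sum_(i < N.*2.+1) \sum_(j < N.*2.+1)
    hcoef N i j * v ^+ i * w ^+ j.
  have -> : ((v + w) ^+ 2 + 1) ^+ N = ev (hpoly 1 ^+ N) v w.
    by rewrite /ev /hpoly !hornerE.
  rewrite (@ev_wide _ N.*2.+1).
    by apply: eq_bigr => i _; apply: eq_bigr => j _; rewrite coef_hpoly_exp.
  by move=> i j ij; rewrite coef_hpoly_exp h0//; lia.
pose f (p : nat * nat) : R := if (r <= p.1)%N && (s <= p.2)%N then
      hcoef N (p.1 - r) (p.2 - s) * v ^+ p.1 * w ^+ p.2 else 0.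
pose K := index_iota 0 N.*2.+1.
have -> : v ^+ r * w ^+ s * ((v + w) ^+ 2 + 1) ^+ N =
    \sum_(p <- [seq (r + i, s + j)%N | i <- K, j <- K]) f p.
  rewrite big_allpairs_dep hE /K [RHS]big_mkord mulr_sumr; apply: eq_bigr => i _.
  rewrite [RHS]big_mkord mulr_sumr; apply: eq_bigr => j _.
  rewrite /f /= !leq_addr/= ![(_ + _ - _)%N]addKn !exprD; ring.
apply: has_sum_finsupp.
  apply: allpairs_uniq; rewrite ?iota_uniq// => -[i j] [i' j'] _ _ /=.
  by move=> [/addnI -> /addnI ->].
move=> [i j] ij; rewrite /f /=; case: ifP => // /andP[ri sj].
rewrite h0 ?mul0r//; rewrite ltnNge; apply: contra ij => ij.
apply/allpairsP; exists (i - r, j - s)%N; rewrite /K !mem_index_iota/= !subnKC//.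
split => //; lia.
Qed.

(* Summed over (r, s) first, these terms give the coefficients (5); summed over
   (i, j) first, they give powers of (v + w)^2 + 1. *)
Definition gen_term v w y z (t : ((nat * nat) * (nat * nat)) * (nat * nat)) : R :=
  let: (i, j) := t.1.1 in let: (m, n) := t.1.2 in let: (r, s) := t.2 in
  if (r <= i)%N && (s <= j)%N then
    gcoef m n r s * (hcoef (m + n).+1 (i - r) (j - s) * v ^+ i * w ^+ j)
      * y ^+ m.+1 * z ^+ n.+1
  else 0.

(** The coefficients grow at most like a power of 2 with exponent linear in the indices. The radius
    2^-6 absorbs this and leaves a factor 1/2 per unit of each of the six indices; the decay in i
    and j pays for r <= i and s <= j. *)
Lemma abs_summable_gen_term v w y z : `|v| <= 2^-1 ^+ 6 -> `|w| <= 2^-1 ^+ 6 ->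
  `|y| <= 2^-1 ^+ 6 -> `|z| <= 2^-1 ^+ 6 -> abs_summable (gen_term v w y z).
Proof.
move=> v6 w6 y6 z6.
have h2 : 0 <= 2^-1 :> R by [].
have hX x k : `|x| <= 2^-1 ^+ 6 -> `|x| ^+ k <= 2^-1 ^+ (6 * k).
  by move=> x6; rewrite exprM lerXn2r ?nnegrE// exprn_ge0.
have := abs_summable_prod (abs_summable_prod abs_summable_half2 abs_summable_half2)
  abs_summable_half2.
apply: abs_summable_le => -[[[i j] [m n]] [r s]]; rewrite /gen_term /=.
case: ifP => [/andP[ri sj]|_]; last by rewrite normr0.
rewrite !mul1r -!exprD [leRHS]ger0_norm ?exprn_ge0//.
rewrite 5!normrM !normrX.
apply: (@le_trans _ _ (2 ^+ (2 * (r + s) + (m + n)) *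
  (2 ^+ ((m + n).+1 + ((i - r) + (j - s))) * 2^-1 ^+ (6 * i) * 2^-1 ^+ (6 * j)) *
   2^-1 ^+ (6 * m.+1) * 2^-1 ^+ (6 * n.+1))).
  apply: ler_pM; rewrite ?mulr_ge0 ?exprn_ge0// ?hX//.
  apply: ler_pM; rewrite ?mulr_ge0 ?exprn_ge0// ?hX//.
  apply: ler_pM; rewrite ?mulr_ge0 ?exprn_ge0//; first exact: gcoef_le.
  apply: ler_pM; rewrite ?mulr_ge0 ?exprn_ge0// ?hX//.
  apply: ler_pM; rewrite ?mulr_ge0 ?exprn_ge0// ?hX//; exact: hcoef_le.
have -> : 2 ^+ (2 * (r + s) + (m + n)) *
  (2 ^+ ((m + n).+1 + ((i - r) + (j - s))) * 2^-1 ^+ (6 * i) * 2^-1 ^+ (6 * j)) *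
   2^-1 ^+ (6 * m.+1) * 2^-1 ^+ (6 * n.+1) =
   2 ^+ (2 * (r + s) + (m + n) + ((m + n).+1 + ((i - r) + (j - s)))) *
   2^-1 ^+ (6 * i + 6 * j + 6 * m.+1 + 6 * n.+1) :> R.
  by rewrite !exprD; ring.
set A := (X in 2 ^+ X * _); set C := (X in _ * 2^-1 ^+ X).
have AC : (A <= C)%N by rewrite /A /C; lia.
rewrite -(subnK AC) exprD mulrCA -exprMn divff ?pnatr_eq0// expr1n mulr1.
by apply: ler_wiXn2l; rewrite ?invf_le1 ?ler1n//; rewrite /A /C; lia.
Qed.

Lemma has_sum_gen_row v w y z (q : (nat * nat) * (nat * nat)) :
  has_sum (fun p => gen_term v w y z (q, p))
    ((numer 1 q.2.1 q.2.2)`_q.1.1`_q.1.2 * v ^+ q.1.1 * w ^+ q.1.2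
       * y ^+ q.2.1.+1 * z ^+ q.2.2.+1).
Proof.
case: q => [[i j] [m n]] /=.
pose Ki := index_iota 0 i.+1; pose Kj := index_iota 0 j.+1.
have -> : (numer 1 m n)`_i`_j * v ^+ i * w ^+ j * y ^+ m.+1 * z ^+ n.+1 =
    \sum_(p <- [seq (r, s) | r <- Ki, s <- Kj])
      gen_term v w y z (((i, j), (m, n)), p).
  rewrite big_allpairs_dep /Ki [RHS]big_mkord coef_numer !mulr_suml.
  apply: eq_bigr => r _; rewrite /Kj [RHS]big_mkord !mulr_suml.
  apply: eq_bigr => s _; rewrite /gen_term /=.
  have := ltn_ord r; have := ltn_ord s; rewrite !ltnS => -> -> /=; ring.
apply: has_sum_finsupp.
  by apply: allpairs_uniq; rewrite ?iota_uniq// => -[? ?] [? ?] _ _ [-> ->].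
move=> [r s] rs; rewrite /gen_term /=; case: ifP => // /andP[ri sj].
case/negP: rs; apply/allpairsP; exists (r, s).
by rewrite /Ki /Kj !mem_index_iota/= !ltnS.
Qed.

(** For fixed (r, s), the sum over (i, j) gives v^r w^s h^(m+n+1); the sums over m and n are then
    binomial series in hy and hz, with values u^(r-1) and t^(s-1). What remains is the odd power
    series at v u and w t. *)
Lemma has_sum_numer v w y z : `|v| <= 2^-1 ^+ 6 -> `|w| <= 2^-1 ^+ 6 ->
  `|y| <= 2^-1 ^+ 6 -> `|z| <= 2^-1 ^+ 6 ->
  let h := (v + w) ^+ 2 + 1 in
  let u := Num.sqrt (1 - h * y) in
  let t := Num.sqrt (1 - h * z) in
  has_sum (fun p : (nat * nat) * (nat * nat) =>
      (numer 1 p.2.1 p.2.2)`_p.1.1`_p.1.2 * v ^+ p.1.1 * w ^+ p.1.2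
        * y ^+ p.2.1.+1 * z ^+ p.2.2.+1)
    (h * y * z / (u * t) * ((v * u + w * t) / ((v * u + w * t) ^+ 2 + 1))).
Proof.
move=> v6 w6 y6 z6 h u t.
have e6 : 2^-1 ^+ 6 = 1 / 64 :> R by field.
have Fs := abs_summable_gen_term v6 w6 y6 z6.
move: v6 w6 y6 z6; rewrite e6 => v6 w6 y6 z6.
have [S FS] := abs_summable_has_sum Fs.
rewrite -/h in u t *.
have S1 := has_sum_rows FS (@has_sum_gen_row v w y z).
have y1 : `|h * y| <= 1 / 4.
  have ? : `|h| <= 2.
    move: v6 w6; rewrite !ler_norml => /andP[? ?] /andP[? ?].
    by rewrite /h; apply/andP; split; nra.
  by rewrite normrM; have := normr_ge0 h; have := normr_ge0 y; nra.
have z1 : `|h * z| <= 1 / 4.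
  have ? : `|h| <= 2.
    move: v6 w6; rewrite !ler_norml => /andP[? ?] /andP[? ?].
    by rewrite /h; apply/andP; split; nra.
  by rewrite normrM; have := normr_ge0 h; have := normr_ge0 z; nra.
pose g (p : nat * nat) : R := if odd (p.1 + p.2) then
      (-1) ^+ (p.1 + p.2)./2 * 'C(p.1 + p.2, p.2)%:R * (v * u) ^+ p.1
        * (w * t) ^+ p.2 else 0.
have sqrt_le2 x : `|x| <= 1 / 4 -> 0 <= Num.sqrt (1 - x) <= 2.
  rewrite ler_norml => /andP[x1 x2]; rewrite sqrtr_ge0/=.
  have := sqr_sqrtr (_ : 0 <= 1 - x); have := sqrtr_ge0 (1 - x); nra.
have G : has_sum g ((v * u + w * t) / ((v * u + w * t) ^+ 2 + 1)).
  have /andP[u0 u2] := sqrt_le2 _ y1; have /andP[t0 t2] := sqrt_le2 _ z1.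
  apply: has_sum_odd_powers; rewrite normrM.
    by rewrite (ger0_norm u0); have := normr_ge0 v; nra.
  by rewrite (ger0_norm t0); have := normr_ge0 w; nra.
(* Reorders the indices as (r, s), then (m, n), then (i, j). *)
pose sw (q : (nat * nat) * ((nat * nat) * (nat * nat))) := ((q.2.2, q.2.1), q.1).
pose sw' (q : ((nat * nat) * (nat * nat)) * (nat * nat)) := (q.2, (q.1.2, q.1.1)).
have swK : cancel sw sw' by move=> [? [? ?]].
have swK' : cancel sw' sw by move=> [[? ?] ?].
have FS' := has_sum_bij swK swK' FS.
have Fs' := abs_summable_bij (can_inj swK) Fs.
suff row p : has_sum (fun q => (gen_term v w y z \o sw) (p, q))
    (h * y * z / (u * t) * g p).
  by rewrite (has_sum_unique (has_sumZ G) (has_sum_rows FS' row)); exact: S1.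
apply: (has_sum_of_rows (g := fun q : nat * nat => gcoef q.1 q.2 p.1 p.2 *
    (v ^+ p.1 * w ^+ p.2 * h ^+ (q.1 + q.2).+1) * y ^+ q.1.+1 * z ^+ q.2.+1)).
- exact: (abs_summable_row p Fs').
- move=> [m n]; rewrite /= /sw /=.
  have := has_sumZ (k := gcoef m n p.1 p.2 * y ^+ m.+1 * z ^+ n.+1)
    (@has_sum_hcoef (m + n).+1 v w p.1 p.2).
  rewrite -/h (_ : _ * (_ * _ ^+ _) = gcoef m n p.1 p.2 *
    (v ^+ p.1 * w ^+ p.2 * h ^+ (m + n).+1) * y ^+ m.+1 * z ^+ n.+1); last by ring.
  congr has_sum; apply/funext => -[i j]; rewrite /gen_term /=; case: p => r s /=.
  by case: ifP => _; [ring|rewrite mulr0].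
have [bs1 B1] := has_sum_beta p.1 y1; have [bs2 B2] := has_sum_beta p.2 z1.
rewrite /g /gcoef; case: ifPn => od; last first.
  by rewrite mulr0; apply: has_sum0 => q; rewrite !mul0r.
have := has_sumZ (k := (-1) ^+ (p.1 + p.2)./2 * 'C(p.1 + p.2, p.2)%:R *
   v ^+ p.1 * w ^+ p.2 * h * y * z) (has_sum_mul bs1 bs2 B1 B2).
rewrite -/u -/t.
have -> : (-1) ^+ (p.1 + p.2)./2 * 'C(p.1 + p.2, p.2)%:R *
   v ^+ p.1 * w ^+ p.2 * h * y * z * (u ^+ p.1 / u * (t ^+ p.2 / t)) =
   h * y * z / (u * t) * ((-1) ^+ (p.1 + p.2)./2 * 'C(p.1 + p.2, p.2)%:R *
   (v * u) ^+ p.1 * (w * t) ^+ p.2).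
  by rewrite invfM !exprMn; ring.
congr has_sum; apply/funext => q.
by rewrite !exprMn [h ^+ _.+1]exprS exprD [y ^+ _.+1]exprS [z ^+ _.+1]exprS; ring.
Qed.

End coef_generating.

(** * The theorem *)

Section coef_support.
Context {R : realType}.
Implicit Types (m n r s i j k : nat).

Lemma beta_odd m k : (k < m)%N -> beta m k.*2.+1 = 0 :> R.
Proof.
move=> km; rewrite /beta /gbinom.
have -> : (k.*2.+1%:R - 1) / 2 = k%:R :> R.
  by rewrite -natr1 addrK -mul2n natrM; field.
by rewrite (bigD1 (Ordinal km))//= subrr !(mul0r, mulr0).
Qed.

(** One of r, s is odd, say r = 2k + 1 with k < m; then (r-1)/2 = k is a natural number below m and
    its binomial coefficient vanishes. *)
Lemma gcoef_small m n r s : (r <= 2 * m)%N -> (s <= 2 * n)%N -> gcoef m n r s = 0 :> R.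
Proof.
move=> rm sn; rewrite /gcoef oddD; case: ifP => // h.
have := odd_double_half r; have := odd_double_half s; move: h.
case: (odd r) => /=; case: (odd s) => //= _ hs hr.
  by rewrite -hr add1n beta_odd ?mulr0 ?mul0r//; lia.
by rewrite -hs add1n beta_odd ?mulr0 ?mul0r//; lia.
Qed.

(** Parity and degree come from homogeneity. If i <= 2m and j <= 2n, then all r <= i and s <= j in
    [coef_numer] fall under [gcoef_small]. *)
Lemma numer_support m n i j :
  ~~ [&& odd (i + j), (i + j <= (2 * (m + n)).+1)%N
       & (2 * m < i)%N || (2 * n < j)%N] -> (numer (1 : R) m n)`_i`_j = 0.
Proof.
have [_ h] := @homog_numer R m n.
case: (boolP ((i + j <= (2 * (m + n)).+1)%N &&
    (odd (i + j) == odd (2 * (m + n)).+1))); last first.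
  by move=> /h.
rewrite /= mul2n odd_double eqb_id => /andP[-> ->] /=.
rewrite negb_or -!leqNgt => /andP[im jn].
rewrite coef_numer big1// => r _; rewrite big1// => s _.
rewrite gcoef_small ?mul0r//.
  by apply: leq_trans im; rewrite -ltnS.
by apply: leq_trans jn; rewrite -ltnS.
Qed.

Lemma ev_numer (q c e : R) m n : ev (numer q m n) c e =
  \sum_(i < (2 * (m + n)).+2) \sum_(j < (2 * (m + n)).+2)
    (numer 1 m n)`_i`_j * q ^+ ((2 * (m + n)).+1 - (i + j))./2 * c ^+ i * e ^+ j.
Proof.
have [h _] := @homog_numer R m n.
rewrite (@ev_wide _ _ (2 * (m + n)).+2).
  by apply: eq_bigr => i _; apply: eq_bigr => j _; rewrite h.
move=> i j ij; rewrite h numer_support ?mul0r//; apply/negP => /and3P[_ + _]; lia.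
Qed.

Lemma half_sub_odd D i : (i <= D)%N -> odd i -> odd D -> (i + 2 * (D - i)./2)%N = D.
Proof. 
move=> iD oi oD; rewrite mul2n halfK oddB// oi oD subn0 subnKC//.
Qed.

Lemma numer_term_le (q c e H d : R) m n i j :
  0 < c -> 0 <= e -> 0 <= q -> 0 < H -> c ^+ 2 <= H -> e ^+ 2 <= H -> q <= H ->
  (numer 1 m n)`_i`_j * q ^+ ((2 * (m + n)).+1 - (i + j))./2 * c ^+ i * e ^+ j <=
  `|(numer (1 : R) m n)`_i`_j| *
     (c ^+ (2 * m).+1 * H ^+ n + e ^+ (2 * n).+1 * H ^+ m).
Proof.
move=> c0 e0 q0 H0 cH eH qH.
have [->|] := eqVneq ((numer (1 : R) m n)`_i`_j) 0.
  by rewrite normr0 !mul0r.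
move=> nz; have /and3P[oij ijD mn] : [&& odd (i + j), (i + j <= (2 * (m + n)).+1)%N
       & (2 * m < i)%N || (2 * n < j)%N].
  by apply: contraR nz => /numer_support ->.
set k := (_ - _)./2.
have ek : (i + j + 2 * k = (2 * (m + n)).+1)%N.
  by rewrite half_sub_odd//= mul2n odd_double.
clearbody k.
rewrite -!mulrA; apply: le_trans (ler_norm _) _; rewrite normrM ler_wpM2l//.
rewrite ger0_norm; last by rewrite !mulr_ge0 ?exprn_ge0// ltW.
(* c, e and sqrt q are at most sqrt H, so that the monomial, of degree
   2(m+n)+1, is compared with its factor c^(2m+1) or e^(2n+1). *)
pose T := Num.sqrt H.
have T0 : 0 <= T by exact: sqrtr_ge0.
have TT : T ^+ 2 = H by rewrite sqr_sqrtr// ltW.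
have cT : c <= T by rewrite -(@ler_pXn2r _ 2)// ?nnegrE ?TT// ltW.
have eT : e <= T by rewrite -(@ler_pXn2r _ 2)// ?nnegrE ?TT.
have qT : q ^+ k <= T ^+ (2 * k).
  by rewrite exprM TT lerXn2r// nnegrE// ltW.
have powc l : c ^+ l <= T ^+ l by rewrite lerXn2r// nnegrE// ltW.
have powe l : e ^+ l <= T ^+ l by rewrite lerXn2r// nnegrE.
case/orP: mn => [mi|nj].
  rewrite -[leLHS]addr0 lerD ?mulr_ge0 ?exprn_ge0 ?(ltW H0)//.
  rewrite -(subnKC mi) exprD mulrCA -mulrA ler_wpM2l ?exprn_ge0 ?(ltW c0)//.
  apply: (@le_trans _ _ (T ^+ (i - (2 * m).+1) * (T ^+ (2 * k) * T ^+ j))).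
    by rewrite !ler_pM ?mulr_ge0 ?exprn_ge0 ?(ltW c0)// ler_pM ?exprn_ge0.
  have e2 : (i - (2 * m).+1 + (2 * k + j) = 2 * n)%N.
    by move: ek mi {nz oij ijD}; lia.
  by rewrite -!exprD e2 -TT -exprM.
rewrite -[leLHS]add0r lerD ?mulr_ge0 ?exprn_ge0 ?(ltW H0) ?(ltW c0)//.
rewrite -(subnKC nj) exprD 2!mulrA [q ^+ k * _ * _]mulrC -mulrA ler_wpM2l ?exprn_ge0//.
apply: (@le_trans _ _ (T ^+ (2 * k) * T ^+ i * T ^+ (j - (2 * n).+1))).
  by rewrite !ler_pM ?mulr_ge0 ?exprn_ge0 ?(ltW c0)// ler_pM ?exprn_ge0 ?(ltW c0).
have e2 : (2 * k + i + (j - (2 * n).+1) = 2 * m)%N.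
  by move: ek nj {nz oij ijD}; lia.
by rewrite -!exprD e2 -TT -exprM.
Qed.

End coef_support.

Section main_parts.
Context {R : realType}.
Implicit Types (a b c d : R) (m n i j : nat).

(** [numer] counts its exponents from 0, hence the predecessors; 0 is a default value outside m, n
    >= 1. *)
Definition coef m n i j : R :=
  if (0 < m)%N && (0 < n)%N then (numer 1 m.-1 n.-1)`_i`_j else 0.

Lemma big_ord_if_eq (F : nat -> R) D (t : nat) (P : pred nat) :
  (forall k, P k = (k == t)) -> (t < D)%N -> \sum_(k < D | P k) F k = F t.
Proof.
by move=> Pt tD; rewrite (big_pred1 (Ordinal tD)).
Qed.

Lemma integral_formula m n a b c d :
  (1 <= m)%N -> (1 <= n)%N -> 0 <= a -> 0 < c -> 0 < d ->
  integral_mn a b c d m n =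
          (pi / ((c + a * d) ^+ 2 + a ^+ 2 * b ^+ 2) ^+ (m + n - 1)
           * (1 / c ^+ (2 * m - 1)) * (1 / d ^+ (2 * n - 1))
           * \sum_(i < (2 * (m + n) - 3).+1) \sum_(j < (2 * (m + n) - 3).+1)
               \sum_(k < (2 * (m + n) - 3).+1 |
                       (i + j + 2 * k == 2 * (m + n) - 3)%N
                       && ((2 * m - 1 <= i)%N || (2 * n - 1 <= j)%N))
                 coef m n i j * c ^+ i * (a * d) ^+ j * (a * b) ^+ (2 * k))%:E.
Proof.
case: m n => // m [//|n] _ _ a0 c0 d0.
rewrite integral_mnE// Jint_numer// ev_numer; congr EFin.
have -> : (m.+1 + n.+1 - 1 = (m + n).+1)%N by lia.
have -> : (2 * (m.+1 + n.+1) - 3 = (2 * (m + n)).+1)%N by lia.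
have -> : (2 * m.+1 - 1 = (2 * m).+1)%N by lia.
have -> : (2 * n.+1 - 1 = (2 * n).+1)%N by lia.
rewrite exprMn -exprMn.
set S1 := (X in pi * X / _); set S2 := (X in _ = _ * X).
suff -> : S1 = S2 by rewrite !invfM exprMn; ring.
apply: eq_bigr => i _; apply: eq_bigr => j _; rewrite /coef /=.
case: (boolP [&& odd (i + j), (i + j <= (2 * (m + n)).+1)%N
       & (2 * m < i)%N || (2 * n < j)%N]) => [/and3P[oij ijD ->]|h]; last first.
  rewrite numer_support// !mul0r big1// => k _; rewrite !mul0r//.
have oD : odd (2 * (m + n)).+1 by rewrite /= mul2n odd_double.
have := half_sub_odd ijD oij oD.
set k0 := (_ - _)./2 => ek.
(* The sum over k has the single admissible index [k0], the exponent of (ab)^2 dictated by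
   homogeneity. *)
rewrite (@big_ord_if_eq (fun k => (numer 1 m n)`_i`_j * c ^+ i * (a * d) ^+ j
    * (a * b) ^+ (2 * k)) _ k0
  (fun k => (i + j + 2 * k == (2 * (m + n)).+1)%N && true)).
- by rewrite exprM; ring.
- by move=> k; rewrite andbT; apply/eqP/eqP; clearbody k0; move: ek; lia.
- by clearbody k0; move: ek; lia.
Qed.

Lemma integral_bound m n a b c d :
  0 <= a -> 0 < c -> 0 < d ->
  (integral_mn a b c d m.+1 n.+1 <=
   ((pi * \sum_(i < (2 * (m + n)).+2) \sum_(j < (2 * (m + n)).+2)
       `|(numer (1 : R) m n)`_i`_j|) *
    (a ^+ (2 * n).+1 / ((c + a * d) ^+ 2 + a ^+ 2 * b ^+ 2) ^+ n.+1
       * (1 / c ^+ (2 * m).+1)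
     + 1 / ((c + a * d) ^+ 2 + a ^+ 2 * b ^+ 2) ^+ m.+1
       * (1 / d ^+ (2 * n).+1)))%:E)%E.
Proof.
move=> a0 c0 d0; rewrite integral_mnE// Jint_numer// ev_numer lee_fin -exprMn.
set H := _ + (a * b) ^+ 2.
have cad : 0 < c + a * d by rewrite ltr_wpDr// mulr_ge0// ltW.
have H0 : 0 < H by rewrite /H ltr_wpDr ?sqr_ge0// exprn_gt0.
have ad0 : 0 <= a * d by rewrite mulr_ge0// ltW.
have cH : c ^+ 2 <= H.
  rewrite /H -[leLHS]addr0 lerD ?sqr_ge0// lerXn2r ?nnegrE ?(ltW c0) ?(ltW cad)//.
  by rewrite lerDl.
have eH : (a * d) ^+ 2 <= H.
  rewrite /H -[leLHS]addr0 lerD ?sqr_ge0// lerXn2r ?nnegrE ?(ltW cad)//.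
  by rewrite lerDr ltW.
have qH : (a * b) ^+ 2 <= H by rewrite /H lerDr sqr_ge0.
set S := \sum_(i < _) _; set S2 := \sum_(i < _) _.
have SS : S <= S2 * (c ^+ (2 * m).+1 * H ^+ n + (a * d) ^+ (2 * n).+1 * H ^+ m).
  rewrite mulr_suml; apply: ler_sum => i _; rewrite mulr_suml; apply: ler_sum => j _.
  by apply: numer_term_le => //; exact: sqr_ge0.
have D0 : 0 < H ^+ (m + n).+1 * c ^+ (2 * m).+1 * d ^+ (2 * n).+1.
  by rewrite !mulr_gt0// exprn_gt0.
have p0 : 0 < pi :> R by exact: pi_gt0.
rewrite ler_pdivrMr//; apply: le_trans (ler_wpM2l (ltW p0) SS) _.
(* An equality from here on: after division by the common denominator, the term in c^(2m+1) gives
   the second summand of the bound and the term in (ad)^(2n+1) the first. *)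
rewrite le_eqVlt; apply/orP; left; apply/eqP.
rewrite -[(m + n).+1]addn1 !exprD exprMn !exprS.
move: (pi : R) => P.
have h1 : H ^+ m != 0 by rewrite expf_neq0// gt_eqF.
have h2 : H ^+ n != 0 by rewrite expf_neq0// gt_eqF.
have h3 : c ^+ (2 * m) != 0 by rewrite expf_neq0// gt_eqF.
have h4 : d ^+ (2 * n) != 0 by rewrite expf_neq0// gt_eqF.
have h5 : H != 0 by rewrite gt_eqF.
have h6 : c != 0 by rewrite gt_eqF.
have h7 : d != 0 by rewrite gt_eqF.
clearbody H S2; field.
by rewrite h1 h2 h3 h4 h5 h6 h7.
Qed.

Lemma majorant_le m n a b c d : 0 <= a -> 0 < c -> 0 < d ->
  a ^+ (2 * n - 1) / ((c + a * d) ^+ 2 + a ^+ 2 * b ^+ 2) ^+ n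
    * (1 / c ^+ (2 * m - 1))
  + 1 / ((c + a * d) ^+ 2 + a ^+ 2 * b ^+ 2) ^+ m * (1 / d ^+ (2 * n - 1))
  <= a ^+ (2 * n - 1) / (a ^+ 2 * b ^+ 2 + a ^+ 2 * d ^+ 2 + c ^+ 2) ^+ n
    * (1 / c ^+ (2 * m - 1))
  + 1 / (a ^+ 2 * b ^+ 2 + a ^+ 2 * d ^+ 2 + c ^+ 2) ^+ m
    * (1 / d ^+ (2 * n - 1)).
Proof.
move=> a0 c0 d0.
have G0 : 0 < a ^+ 2 * b ^+ 2 + a ^+ 2 * d ^+ 2 + c ^+ 2.
  by rewrite ltr_wpDl ?exprn_gt0// addr_ge0// mulr_ge0 ?sqr_ge0.
have GH : a ^+ 2 * b ^+ 2 + a ^+ 2 * d ^+ 2 + c ^+ 2 <=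
    (c + a * d) ^+ 2 + a ^+ 2 * b ^+ 2.
  have : 0 <= c * (a * d) by rewrite !mulr_ge0// ltW.
  by nra.
have inv k : ((c + a * d) ^+ 2 + a ^+ 2 * b ^+ 2) ^- k <=
    (a ^+ 2 * b ^+ 2 + a ^+ 2 * d ^+ 2 + c ^+ 2) ^- k.
  rewrite lef_pV2 ?posrE ?exprn_gt0//; last exact: lt_le_trans GH.
  by rewrite lerXn2r ?nnegrE ?(ltW G0)// (le_trans (ltW G0)).
have cp k : 0 <= 1 / c ^+ k by rewrite divr_ge0// exprn_ge0// ltW.
have dp k : 0 <= 1 / d ^+ k by rewrite divr_ge0// exprn_ge0// ltW.
apply: lerD; apply: ler_wpM2r => //; apply: ler_wpM2l => //.
exact: exprn_ge0.
Qed.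

End main_parts.

Theorem theorem6p1 (R : realType) :
  exists coef : nat -> nat -> nat -> nat -> R,
  [/\ (* (1) *)
      forall (m n : nat) (a b c d : R),
        (1 <= m)%N -> (1 <= n)%N -> 0 <= a -> 0 < c -> 0 < d ->
        integral_mn a b c d m n =
          (pi / ((c + a * d) ^+ 2 + a ^+ 2 * b ^+ 2) ^+ (m + n - 1)
           * (1 / c ^+ (2 * m - 1)) * (1 / d ^+ (2 * n - 1))
           * \sum_(i < (2 * (m + n) - 3).+1) \sum_(j < (2 * (m + n) - 3).+1)
               \sum_(k < (2 * (m + n) - 3).+1 |
                       (i + j + 2 * k == 2 * (m + n) - 3)%N
                       && ((2 * m - 1 <= i)%N || (2 * n - 1 <= j)%N))
                 coef m n i j * c ^+ i * (a * d) ^+ j * (a * b) ^+ (2 * k))%:E,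
      (* (2) *)
      forall m n : nat, (1 <= m)%N -> (1 <= n)%N ->
        exists C : R, forall a b c d : R, 0 <= a -> 0 < c -> 0 < d ->
          (integral_mn a b c d m n <=
            (C * (a ^+ (2 * n - 1) / ((c + a * d) ^+ 2 + a ^+ 2 * b ^+ 2) ^+ n
                    * (1 / c ^+ (2 * m - 1))
                  + 1 / ((c + a * d) ^+ 2 + a ^+ 2 * b ^+ 2) ^+ m
                    * (1 / d ^+ (2 * n - 1))))%:E)%E
          /\ a ^+ (2 * n - 1) / ((c + a * d) ^+ 2 + a ^+ 2 * b ^+ 2) ^+ n
               * (1 / c ^+ (2 * m - 1))
             + 1 / ((c + a * d) ^+ 2 + a ^+ 2 * b ^+ 2) ^+ m
               * (1 / d ^+ (2 * n - 1))
             <= a ^+ (2 * n - 1)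
                  / (a ^+ 2 * b ^+ 2 + a ^+ 2 * d ^+ 2 + c ^+ 2) ^+ n
                  * (1 / c ^+ (2 * m - 1))
                + 1 / (a ^+ 2 * b ^+ 2 + a ^+ 2 * d ^+ 2 + c ^+ 2) ^+ m
                  * (1 / d ^+ (2 * n - 1)),
      (* (3) *)
      forall a b c d : R, 0 <= a -> 0 < c -> 0 < d ->
        exists2 eps : R, 0 < eps & forall y z : R, `|y| < eps -> `|z| < eps ->
          let u := Num.sqrt (c ^+ 2 - y) in
          let t := Num.sqrt (d ^+ 2 - z) in
          has_sum
            (fun p : nat * nat => let: (m, n) := (p.1.+1, p.2.+1) in
               fine (integral_mn a b c d m n) * y ^+ m * z ^+ n)
            (pi * y * z / (u * t)
             * ((u + a * t) / ((u + a * t) ^+ 2 + a ^+ 2 * b ^+ 2))),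
      (* (4) *)
      exists2 eps : R, 0 < eps & forall v w y z : R,
        `|v| < eps -> `|w| < eps -> `|y| < eps -> `|z| < eps ->
          let h := (v + w) ^+ 2 + 1 in
          let u := Num.sqrt (1 - h * y) in
          let t := Num.sqrt (1 - h * z) in
          has_sum
            (fun p : (nat * nat) * (nat * nat) =>
               let: (i, j) := p.1 in let: (m, n) := (p.2.1.+1, p.2.2.+1) in
               coef m n i j * v ^+ i * w ^+ j * y ^+ m * z ^+ n)
            (h * y * z / (u * t)
             * ((v * u + w * t) / ((v * u + w * t) ^+ 2 + 1)))
    & (* (5) *)
      forall m n i j : nat, (1 <= m)%N -> (1 <= n)%N ->
        let cond := [&& odd (i + j), (i + j <= 2 * (m + n) - 3)%N
                      & (2 * m - 1 <= i)%N || (2 * n - 1 <= j)%N] in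
        (~~ cond -> coef m n i j = 0) /\
        (cond -> coef m n i j =
           \sum_(r < i.+1) \sum_(s < j.+1 | odd (r + s))
             (-1) ^+ (m + n + (r + s - 1)./2)
             * 'C(r + s, s)%:R
             * gbinom ((r%:R - 1) / 2 : R) (m - 1)
             * gbinom ((s%:R - 1) / 2 : R) (n - 1)
             * 'C(m + n - 1, m + n - 1 - (i + j - r - s)./2)%:R
             * 'C(i + j - r - s, i - r)%:R)].
Proof.
exists coef; split.
- exact: integral_formula.
- move=> [//|m] [//|n] _ _; eexists => a b c d a0 c0 d0; split; last first.
    exact: majorant_le.
  have -> : (2 * m.+1 - 1 = (2 * m).+1)%N by lia.
  have -> : (2 * n.+1 - 1 = (2 * n).+1)%N by lia.
  exact: integral_bound.
- move=> a b c d a0 c0 d0.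
  (* Within this radius both square roots are positive and both geometric series converge. *)
  exists (Num.min (c ^+ 2) (d ^+ 2)); first by rewrite lt_min !exprn_gt0.
  move=> y z; rewrite !lt_min => /andP[yc _] /andP[_ zd] u t.
  have u0 : 0 < u by rewrite sqrtr_gt0 subr_gt0 (le_lt_trans (ler_norm _)).
  have t0 : 0 < t by rewrite sqrtr_gt0 subr_gt0 (le_lt_trans (ler_norm _)).
  have := @has_sum_Jint R a b c d y z a0 c0 d0 yc zd; rewrite Jint11// -/u -/t.
  rewrite (_ : y * z * _ = pi * y * z / (u * t) *
    ((u + a * t) / ((u + a * t) ^+ 2 + a ^+ 2 * b ^+ 2))); last first.
    by move: (pi : R) => P; rewrite !invfM; ring.
  congr has_sum; apply/funext => -[m n] /=.

- exists (2^-1 ^+ 6); first by rewrite exprn_gt0// invr_gt0.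
  move=> v w y z /ltW v6 /ltW w6 /ltW y6 /ltW z6 h u t.
  have := has_sum_numer v6 w6 y6 z6; rewrite -/h -/u -/t.
  by congr has_sum; apply/funext => -[[i j] [m n]].
- move=> [//|m] [//|n] i j _ _ cond.
  have condE : cond = [&& odd (i + j), (i + j <= (2 * (m + n)).+1)%N
       & (2 * m < i)%N || (2 * n < j)%N].
    rewrite /cond; congr [&& _, (_ <= _)%N & (_ <= _)%N || (_ <= _)%N]; lia.
  rewrite condE; split=> [|/and3P[oij ijD _]]; first exact: numer_support.
  rewrite /coef /= coef_numer; apply: eq_bigr => r _; rewrite [RHS]big_mkcond/=.
  apply: eq_bigr => s _; rewrite /gcoef; case: ifP => ors; last by rewrite mul0r.
  have rI : (r <= i)%N by rewrite -ltnS.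
  have sJ : (s <= j)%N by rewrite -ltnS.
  have e1 : (i + j - r - s = (i - r) + (j - s))%N by lia.
  have ev_ : odd ((i - r) + (j - s)) = false.
    by rewrite -e1 -subnDA oddB ?leq_add// oij ors.
  rewrite /hcoef ev_ e1 !subn1 /=.
  have lN : (((i - r) + (j - s))./2 <= (m + n).+1)%N.
    have := odd_double_half (i - r + (j - s)); lia.
  (* [hcoef] and the stated formula use opposite sides of the symmetry of binomial coefficients,
     here and in the next rewriting. *)
  rewrite addSn addnS /= bin_sub//.
  have -> : 'C((i - r) + (j - s), i - r) = 'C((i - r) + (j - s), j - s).
    by have := bin_sub (leq_addl (i - r) (j - s)); rewrite addnK.
  have -> : (r + s).-1./2 = (r + s)./2.
    by rewrite -subn1 -[in LHS](odd_double_half (r + s)) ors addKn doubleK.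
  (* The signs of the two [beta] factors give (-1)^(m+n); the successors in the stated exponent add
     an even number. *)
  rewrite /beta !exprS !exprD; ring.
Qed.
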